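(* Fix $\gamma_0\ge1$. There exist a constant $C<\infty$ depending only on $\gamma_0$ and an absolute constant $\bar C<\infty$ such that the following holds. Let $n,d$ be positive integers with $1\le d\le n^{\gamma_0}$, let $S_n^d=\sum_{\ell=1}^d P_n^\ell$ where $P_n^\ell(i,j)=\mathbf 1(\pi_n^\ell(i)=j)$ for independent uniformly random permutations $\pi_n^1,\dots,\pi_n^d$ of $[n]$, and let $Z_n$ be a deterministic complex $n\times n$ matrix such that $\|Z_n\|_{\langle\mathbf 1\rangle^\perp}\le n^{\gamma_0}$ and $Z_n\mathbf 1=\zeta\mathbf 1$, $Z_n^*\mathbf 1=\bar\zeta\mathbf 1$ for some $\zeta\in\mathbb C$. Then $$\mathbb P\Big\{ s_n(S_n^d+Z_n)< n^{-\bar C\gamma_0\log_{d\wedge n}n}\wedge|d+\zeta|\Big\}\le C\,\frac{\log^4n}{\sqrt{d\wedge n}}.$$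
   Context: $\mathbf 1\in\mathbb C^n$ is the all-ones vector, $\langle\mathbf 1\rangle^\perp$ its orthogonal complement in $\mathbb C^n$, and for an $n\times n$ matrix $M$, $\|M\|_{\langle\mathbf 1\rangle^\perp}=\sup\{\|Mu\|_2: u\in\mathbb C^n,\ \|u\|_2=1,\ u\perp\mathbf 1\}$. $s_n(\cdot)$ denotes the smallest singular value, $a\wedge b=\min(a,b)$. *)

(* Defs.v *)
From HB Require Import structures.
From mathcomp Require Import all_boot all_order all_algebra all_fingroup.
From mathcomp Require Import all_classical all_reals.
From mathcomp Require Import exp.
From mathcomp Require Import complex.
Set Implicit Arguments. Unset Strict Implicit. Unset Printing Implicit Defensive.
Import Order.TTheory GRing.Theory Num.Theory.
Local Open Scope ring_scope.
Local Open Scope classical_set_scope.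

Section Defs.
Variable R : realType.

Definition vnorm {n : nat} (u : 'cV[R[i]]_n) : R :=
  Num.sqrt (\sum_(i < n) (Normc.normc (u i 0)) ^+ 2).

Definition ones (n : nat) : 'cV[R[i]]_n := const_mx 1.

Definition adjmx {m n : nat} (M : 'M[R[i]]_(m, n)) : 'M[R[i]]_(n, m) :=
  map_mx (@conjc R) M^T.

Definition smin {n : nat} (M : 'M[R[i]]_n) : R :=
  inf [set vnorm (M *m u) | u in [set u : 'cV[R[i]]_n | vnorm u = 1]].

Definition opnorm_perp1 {n : nat} (M : 'M[R[i]]_n) : R :=
  sup [set vnorm (M *m u) | u in
        [set u : 'cV[R[i]]_n | vnorm u = 1 /\ \sum_(i < n) u i 0 = 0]].

Definition Ssum {n d : nat} (pi : {ffun 'I_d -> 'S_n}) : 'M[R[i]]_n :=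
  \sum_(l < d) perm_mx (pi l).

(* probability under d independent uniform permutations of [n], i.e. the
   uniform distribution on d-tuples of permutations *)
Definition Pperm (n d : nat) (E : pred {ffun 'I_d -> 'S_n}) : R :=
  #|E|%:R / #|{ffun 'I_d -> 'S_n}|%:R.

End Defs.

(* Main.v *)
(** Subtracting zeta/n from every entry of Z gives a matrix Z' with zero row and column
    sums, and it suffices to bound S + Z' from below; sup norms are used throughout since
    polynomial factors do not matter.

    A near-null vector u with few values off a small disc ("structured") is excluded level
    by level: as long as fewer than n/(C b) coordinates stay away from the disc, with b the
    number of bits of a net point, a union bound over rounded sparse vectors is beaten by
    the small-ball estimate 2^-N, N of order min(k d, n), where k coordinates are large.
    The latter holds because N marked entries have to hit prescribed rows or collide.
    About log_d n levels are needed, each costing a polynomial factor.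

    If neither u nor the left near-null vector v is structured, each takes on one set of
    n/(C b) and one of n/2 coordinates values that are far apart.  Permutations mix, so for
    many pairs of rows (i, j) the entries v_i, v_j are separated, and u_(pi_l i), u_(pi_l j)
    are for many l.  Swapping pi_l(i) and pi_l(j) at random in each l leaves everything else
    fixed, and Littlewood-Offord gives probability O(1/sqrt(number of such l)).  Averaging
    over the pairs yields O(b^2 / sqrt d), with b of order log^2 n. *)

Require Import Defs.
From HB Require Import structures.
From mathcomp Require Import all_boot all_order all_algebra all_fingroup.
From mathcomp Require Import all_classical all_reals.
From mathcomp Require Import sequences exp.
From mathcomp Require Import complex.
From mathcomp Require Import zify ring lra.
Set Implicit Arguments. Unset Strict Implicit. Unset Printing Implicit Defensive.
Import Order.TTheory GRing.Theory Num.Theory.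
Local Open Scope ring_scope.

(** * Small balls for sparse vectors *)

(** The factor [|d + zeta|] is what makes the centring harmless: constant vectors are multiplied by
    [d + zeta], whose modulus is not below the threshold, so by Pythagoras a vector with too small
    an image already has a small image on its part orthogonal to the constants.

    The obstacle in the unstructured case is that [u] depends on the permutations that are to be
    resampled. Hence only a property of [u] that the swaps preserve is kept: a small image off the
    two rows, and a small sum of the images on the two rows. Such a [u] can be fixed before the
    swaps are drawn. What is lost, the difference of the two images, comes back from pairing with a
    left near-null vector [v], which may be chosen anew after the swaps.

    Littlewood-Offord is used in the form (number of large coefficients) times (probability) at most
    [sqrt d]. It is linear in the number, so no single pair of rows needs many good [l]; only the
    total over pairs has to be large, uniformly in the sets.

    The fourth power of the logarithm: [m] levels of loss [n ^ O(gamma)] need [b] of order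
    [gamma m log n] bits, [m] is at most of order [log n], and [b] enters squared. *)

Section Balls.
Variables n d : nat.
Implicit Types (pi : {ffun 'I_d -> 'S_n}) (p : 'I_d * 'I_n) (B : {set 'I_n}).

(** A ball [(l, a)] is the entry in column [a] of the [l]-th permutation matrix; the row it falls
    into is what is random. *)
Definition ball_row pi p : 'I_n := (pi p.1)^-1%g p.2.

(** Exchanging the values [p.2] and [b] moves the ball [p] to the row that held [b]; averaging over
    [b] resamples its row. *)
Definition ball_swap p (b : 'I_n) pi : {ffun 'I_d -> 'S_n} :=
  [ffun l => if l == p.1 then (pi l * tperm p.2 b)%g else pi l].

Lemma ball_swapE p b pi l i :
  ball_swap p b pi l i = if l == p.1 then tperm p.2 b (pi l i) else pi l i.
Proof. by rewrite ffunE; case: eqP => // _; rewrite permM. Qed.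

Lemma ball_swapK p b : involutive (ball_swap p b).
Proof.
move=> pi; apply/ffunP => l; rewrite !ffunE; case: eqP => // _.
by rewrite -mulgA tperm2 mulg1.
Qed.

Lemma ball_row_swap p b pi : ball_row (ball_swap p b pi) p = (pi p.1)^-1%g b.
Proof.
by rewrite /ball_row ffunE eqxx invMg tpermV permM tpermL.
Qed.

Lemma ball_row_swap_neq p q b pi : p != q -> q.2 != b ->
  ball_row (ball_swap p b pi) q = ball_row pi q.
Proof.
move=> pq qb; rewrite /ball_row ffunE; case: eqP => // lq.
rewrite invMg tpermV permM tpermD //; last by rewrite eq_sym.
by apply: contraNneq pq => e; apply/eqP/eqP; rewrite -pair_eqE /= /pair_eq lq e !eqxx.
Qed.

Lemma sum_ball_swap p b (f : {ffun 'I_d -> 'S_n} -> nat) :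
  (\sum_pi f (ball_swap p b pi) = \sum_pi f pi)%N.
Proof.
by rewrite [RHS](reindex_inj (inv_inj (ball_swapK p b))).
Qed.

Lemma size_undup_double (T : eqType) (s : seq T) :
  (forall x, x \in s -> 2 <= count_mem x s)%N -> (2 * size (undup s) <= size s)%N.
Proof.
move=> h.
have -> : size s = (\sum_(x <- undup s) count_mem x s)%N.
  rewrite -sum1_size.
  rewrite [RHS](eq_bigr (fun x => \sum_(y <- s) (y == x))%N); last first.
    by move=> x _; rewrite -sum1_count big_mkcond /=; apply: eq_bigr => y _; case: eqP.
  rewrite exchange_big /= big_seq [RHS]big_seq; apply: eq_bigr => y ys.
  rewrite (bigD1_seq y) ?mem_undup ?undup_uniq //= eqxx big1 ?addn0 // => x.
  by rewrite eq_sym => /negPf ->.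
rewrite -sum1_size big_distrr /= big_seq [X in (_ <= X)%N]big_seq.
by apply: leq_sum => x; rewrite mem_undup muln1; exact: h.
Qed.

Variables (B : {set 'I_n}) (bad : {ffun 'I_d -> 'S_n} -> {set 'I_n}).
Variable Q : seq ('I_d * 'I_n).
Hypothesis Q_notB : forall p, p \in Q -> p.2 \notin B.
Hypothesis bad_swap : forall p b pi, p \in Q -> b \in B ->
  bad (ball_swap p b pi) = bad pi.
Let N := size Q.
Hypothesis N_small : (32 * N <= #|B|)%N.

Let rows P pi := [seq ball_row pi p | p <- P].
Let fresh P pi := size (undup [seq i <- rows P pi | i \notin bad pi]).
(** Every ball that opens no new good row costs a factor 16. The cutoff bounds the forbidden rows by
    [2 N], and it is stable because the swaps leave [bad] unchanged. *)
Let wt P pi := if (#|bad pi| <= N)%N then (16 ^ (size P - fresh P pi))%N else 0%N.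

Let freshS p P pi : fresh (p :: P) pi =
  (((ball_row pi p \notin bad pi) && (ball_row pi p \notin rows P pi)) + fresh P pi)%N.
Proof.
rewrite /fresh /=; case: ifP => //= h; rewrite mem_filter h /=.
by case: ifP.
Qed.

Let fresh_le P pi : (fresh P pi <= size P)%N.
Proof.
rewrite /fresh (leq_trans (size_undup _)) // size_filter (leq_trans (count_size _ _)) //.
by rewrite size_map.
Qed.

(* Resampling one ball uniformly among the rows of [B] makes it land on one of the
   at most [2 N] bad or already occupied rows with probability at most [1/16]. *)
Let sum_wtS p P : uniq (p :: P) -> {subset p :: P <= Q} ->
  (\sum_pi wt (p :: P) pi <= 2 * \sum_pi wt P pi)%N.
Proof.
case/andP => pP uP sPQ.
have pQ : p \in Q by apply: sPQ; rewrite mem_head.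
case: (posnP #|B|) => [B0|Bpos].
  move: N_small; rewrite B0 leqn0 muln_eq0 /= => /eqP N0.
  by move: pQ; rewrite (size0nil N0).
rewrite -(leq_pmul2l Bpos) -sum1_card big_distrl /=.
rewrite (eq_bigr (fun b => \sum_pi wt (p :: P) (ball_swap p b pi)))%N; last first.
  by move=> b _; rewrite mul1n sum_ball_swap.
rewrite exchange_big /= mulnA mulnC big_distrl /= sum1_card; apply: leq_sum => pi _.
rewrite (eq_bigr (fun b => wt P pi *
   (if ((pi p.1)^-1%g b \in bad pi) || ((pi p.1)^-1%g b \in rows P pi)
    then 16 else 1)))%N; last first.
  move=> b bB; rewrite /wt bad_swap //; case: ifP => // _.
  have rowsE : rows P (ball_swap p b pi) = rows P pi.
    apply/eq_in_map => q qP; apply: ball_row_swap_neq.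
      by apply: contraNneq pP => ->.
    have qQ : q \in Q by apply: sPQ; rewrite inE qP orbT.
    by apply: contraNneq (Q_notB qQ) => ->.
  have freshE : fresh P (ball_swap p b pi) = fresh P pi.
    by rewrite /fresh rowsE bad_swap.
  rewrite freshS freshE rowsE bad_swap // ball_row_swap /=.
  rewrite -negb_or; case: ifP => _ /=.
    by rewrite add0n subSn ?fresh_le // expnS mulnC.
  by rewrite add1n subSS muln1.
rewrite -big_distrr /= leq_mul2l /wt; case: ifP => //= badN; apply/orP; right.
set F := [set b | ((pi p.1)^-1%g b \in bad pi) || ((pi p.1)^-1%g b \in rows P pi)].
have FN : (#|F| <= 2 * N)%N.
  have -> : F = (pi p.1) @: (bad pi :|: [set i in rows P pi]).
    apply/setP => b; rewrite inE; apply/idP/imsetP => [h|[j]].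
      by exists ((pi p.1)^-1%g b); rewrite ?permKV // !inE.
    by rewrite !inE => h ->; rewrite permK.
  rewrite (leq_trans (leq_imset_card _ _)) // (leq_trans (leq_card_setU _ _)) //.
  rewrite mul2n -addnn leq_add // cardsE (leq_trans (card_size _)) //.
  rewrite size_map; apply: uniq_leq_size => // q qP.
  by apply: sPQ; rewrite inE qP orbT.
(* At most [2 N] choices of [b] cost 16 instead of 1, and [|B| + 30 N <= 2 |B|]. *)
apply: (@leq_trans (\sum_(b in B) (1 + (b \in F) * 15))%N).
  by apply: leq_sum => b _; rewrite inE; case: ifP.
rewrite big_split /= sum1_card -big_distrl /=.
have : (\sum_(b in B) (b \in F) <= 2 * N)%N.
  apply: leq_trans FN; rewrite -sum1_card big_mkcond [X in (_ <= X)%N]big_mkcond /=.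
  by apply: leq_sum => b _; case: ifP => _; case: ifP.
move: N_small; set x := (\sum_(b in B) _)%N; set c := #|_|.
rewrite ?sum1_card -/c; lia.
Qed.

Let sum_wt P : uniq P -> {subset P <= Q} ->
  (\sum_pi wt P pi <= 2 ^ size P * #|{ffun 'I_d -> 'S_n}|)%N.
Proof.
elim: P => [|p P IH] uP sP.
  by rewrite mul1n -sum1_card; apply: leq_sum => pi _; rewrite /wt /=; case: ifP.
apply: leq_trans (sum_wtS uP sP) _; rewrite expnS -mulnA leq_pmul2l //.
apply: IH; first by case/andP: uP.
by move=> q qP; apply: sP; rewrite inE qP orbT.
Qed.

(** Markov's inequality for [wt]. Its mean is at most [2 ^ N]; on [ok] every good occupied row holds
    at least two balls, so at most [N / 2] rows are fresh and the weight is at least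
    [16 ^ (N / 2) = 4 ^ N]. *)
Lemma card_doubled_rows (ok : pred {ffun 'I_d -> 'S_n}) :
  uniq Q ->
  (forall pi, ok pi -> (#|bad pi| <= N)%N) ->
  (forall pi p, ok pi -> p \in Q -> ball_row pi p \notin bad pi ->
     exists2 q, q \in Q & q != p /\ ball_row pi q = ball_row pi p) ->
  (#|ok| * 2 ^ N <= #|{ffun 'I_d -> 'S_n}|)%N.
Proof.
move=> uQ okbad okdbl.
have h : (#|ok| * 4 ^ N <= \sum_pi wt Q pi)%N.
  rewrite -sum1_card big_distrl /= big_mkcond /=; apply: leq_sum => pi _.
  case: ifP => // okpi; rewrite mul1n /wt okbad // -/N.
  rewrite (_ : 16 = 4 ^ 2)%N // -expnM leq_exp2l //.
  have : (2 * fresh Q pi <= N)%N.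
    apply: (@leq_trans (size [seq i <- rows Q pi | i \notin bad pi])); last first.
      by rewrite size_filter (leq_trans (count_size _ _)) // size_map.
    apply: size_undup_double => i; rewrite mem_filter => /andP[ibad /mapP[p pQ ip]].
    have [q qQ [qp rqp]] : exists2 q, q \in Q & q != p /\ ball_row pi q = ball_row pi p.
      by apply: okdbl => //; rewrite -ip.
    rewrite count_filter -size_filter.
    rewrite (eq_in_filter (a2 := fun j => j == i)); last first.
      by move=> j _ /=; case: eqP => // ->; rewrite ibad.
    rewrite filter_map size_map.
    have : (size [:: p; q] <= size [seq x <- Q | ball_row pi x == i])%N.
      apply: uniq_leq_size; first by rewrite /= inE eq_sym qp.
      by move=> x; rewrite !inE mem_filter => /orP[]/eqP ->; rewrite ?pQ ?qQ ?rqp ip eqxx.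
    by [].
  move: (fresh_le Q pi); rewrite -/N; lia.
have := leq_trans h (sum_wt uQ (fun _ => id)).
rewrite -/N (_ : 4 = 2 * 2)%N // expnMn mulnA mulnC leq_pmul2l ?expn_gt0 //.
Qed.

End Balls.

(** * The modulus of a complex number *)

Section ComplexNorm.
Variable R : realType.
Local Notation C := R[i].
Local Notation nc := (@Normc.normc R).

Lemma nc_def (z : C) : nc z = Num.sqrt (complex.Re z ^+ 2 + complex.Im z ^+ 2).
Proof. by case: z. Qed.

Lemma nc_ge0 (z : C) : 0 <= nc z.
Proof. by rewrite nc_def sqrtr_ge0. Qed.

Lemma ncD (x y : C) : nc (x + y) <= nc x + nc y.
Proof. exact: le_normcD. Qed.

Lemma ncN (x : C) : nc (- x) = nc x.
Proof. exact: normcN. Qed.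

Lemma ncB (x y : C) : nc (x - y) <= nc x + nc y.
Proof. by rewrite -[nc y]ncN; exact: ncD. Qed.

Lemma nc0 : nc 0 = 0.
Proof. by rewrite nc_def /= expr0n addr0 sqrtr0. Qed.

Lemma nc_sum (I : Type) (s : seq I) (P : pred I) (f : I -> C) :
  nc (\sum_(i <- s | P i) f i) <= \sum_(i <- s | P i) nc (f i).
Proof.
elim/big_rec2: _ => [|i x y _ h]; first by rewrite nc0.
by rewrite (le_trans (ncD _ _)) // lerD2l.
Qed.

Lemma nc_sqr (z : C) : nc z ^+ 2 = complex.Re z ^+ 2 + complex.Im z ^+ 2.
Proof. by rewrite nc_def sqr_sqrtr // addr_ge0 // sqr_ge0. Qed.

Lemma nc_nat (k : nat) : nc k%:R = k%:R.
Proof.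
rewrite (_ : k%:R = real_complex R k%:R); last by rewrite rmorph_nat.
by rewrite nc_def /= expr0n addr0 sqrtr_sqr ger0_norm.
Qed.

Lemma nc_gt0 (z : C) : z != 0 -> 0 < nc z.
Proof.
move=> z0; rewrite lt_neqAle nc_ge0 andbT eq_sym; apply: contraNneq z0 => h.
exact/eqP/Normc.eq0_normc.
Qed.

Lemma Re_le_nc (z : C) : `|complex.Re z| <= nc z.
Proof. by rewrite nc_def -sqrtr_sqr ler_wsqrtr // lerDl sqr_ge0. Qed.

Lemma Im_le_nc (z : C) : `|complex.Im z| <= nc z.
Proof. by rewrite nc_def -sqrtr_sqr ler_wsqrtr // lerDr sqr_ge0. Qed.

Lemma nc_le_ReIm (z : C) : nc z <= `|complex.Re z| + `|complex.Im z|.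
Proof.
rewrite nc_def -[X in _ <= X]ger0_norm ?addr_ge0 // -sqrtr_sqr ler_wsqrtr //.
rewrite sqrrD !real_normK ?num_real // lerD2r lerDl.
by rewrite mulrn_wge0 // mulr_ge0.
Qed.

End ComplexNorm.

(** * The small-ball estimate *)

Section SmallBall.
Variables (R : realType) (n d : nat).
Local Notation C := R[i].
Local Notation nc := (@Normc.normc R).

(** The balls in [Q] are [N] entries where [w] is large. A row whose remaining sum [known] is off
    target must contain one of them, and a row whose remaining sum is on target cannot contain
    exactly one, because [2 tau < r]. The zeros of [w] are the free places for resampling. *)
Lemma sparse_small_ball (w y : 'I_n -> C) (r tau : R) (A : {set 'I_n}) (N : nat) :
  0 <= r -> 2 * tau < r -> (forall a, a \in A -> r < nc (w a)) ->
  (N <= d * #|A|)%N -> (32 * N <= #|[set j | w j == 0%R]|)%N ->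
  (#|[pred pi : {ffun 'I_d -> 'S_n} |
       [forall i, (nc (\sum_(l < d) w (pi l i) - y i) <= tau)%R]]| * 2 ^ N
     <= #|{ffun 'I_d -> 'S_n}|)%N.
Proof.
move=> r0 taur wA NA NB.
set B := [set j | w j == 0] in NB *.
pose Q := take N (enum (finset.setX [set: 'I_d] A)).
have sQ : size Q = N.
  by rewrite size_take -cardE cardsX cardsT card_ord; case: ltngtP NA.
have QA p : p \in Q -> p.2 \in A.
  by move/mem_take; rewrite mem_enum inE => /andP[].
have QB p : p \in Q -> p.2 \notin B.
  move=> /QA /wA h; rewrite inE; apply: contraTneq h => ->.
  by rewrite nc0 -leNgt.
pose known (pi : {ffun 'I_d -> 'S_n}) i :=
  \sum_(l < d | (l, pi l i) \notin Q) w (pi l i).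
pose bad pi := [set i | tau < nc (known pi i - y i)].
(* The swap trades a marked entry, not counted in [known], for a column where [w] vanishes. *)
have bad_swap p b pi : p \in Q -> b \in B -> bad (ball_swap p b pi) = bad pi.
  move=> pQ bB; apply/setP => i; rewrite !inE; congr (_ < nc (_ - _)).
  rewrite /known big_mkcond [RHS]big_mkcond /=; apply: eq_bigr => l _.
  rewrite ball_swapE; case: eqP => [-> |//].
  have bQ : (p.1, b) \notin Q by apply/negP => /QB /=; rewrite bB.
  have w0 : w b = 0 by move: bB; rewrite inE => /eqP.
  have pE : (p.1, p.2) \in Q by case: (p) pQ.
  case: tpermP => [->|->|//]; rewrite ?bQ ?pE /= ?w0 //.
rewrite -sQ; apply: (@card_doubled_rows n d B bad Q) => //.
- by rewrite sQ.
- by rewrite take_uniq // enum_uniq.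
- move=> pi /forallP okpi; rewrite -(size_map (ball_row pi) Q).
  apply: leq_trans (card_size _); apply: subset_leq_card; apply/fintype.subsetP => i.
  rewrite inE ltNge; apply: contraR => /mapP h.
  suff -> : known pi i = \sum_(l < d) w (pi l i) by exact: okpi.
  rewrite /known big_mkcond; apply: eq_bigr => l _; case: ifPn => // /negPn hQ.
  by case: h; exists (l, pi l i) => //; rewrite /ball_row /= permK.
- move=> pi [l a] /forallP okpi pQ; set i := ball_row pi _; rewrite inE -leNgt => kn.
  have pia : pi l i = a by rewrite /i /ball_row /= permKV.
  case: (pselect (exists2 k, k != l & (k, pi k i) \in Q)) => [[k kl kQ]|h].
    exists (k, pi k i) => //; split; last by rewrite /ball_row /= permK.
    by apply: contraNneq kl => -[-> _].
  have wa := wA a (QA _ pQ).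
  have e : \sum_(l < d) w (pi l i) = known pi i + w a.
    rewrite (bigID (fun k => (k, pi k i) \notin Q)) /=; congr (_ + _).
    rewrite (big_pred1 l) ?pia // => k /=; rewrite negbK.
    apply/idP/eqP => [kQ|->]; last by rewrite pia.
    by apply/eqP; apply: contra_notT h => kl; exists k.
  have := okpi i; rewrite e => ok1.
  have : nc (w a) <= tau + tau.
    rewrite (_ : w a = (known pi i + w a - y i) - (known pi i - y i)); last by ring.
    by rewrite (le_trans (ncB _ _)) // lerD.
  move: wa taur; lra.
Qed.

End SmallBall.

(** * Structured near-null vectors *)

Section Counting.
Variable T : finType.

Definition cnt (P : T -> Prop) : nat := #|[pred x | `[< P x >]]|.

Lemma in_cnt (P : T -> Prop) x : (x \in [pred x | `[< P x >]]) = `[< P x >].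
Proof. by []. Qed.

Lemma cnt_le (P P' : T -> Prop) : (forall x, P x -> P' x) -> (cnt P <= cnt P')%N.
Proof.
move=> h; apply: subset_leq_card; apply/fintype.subsetP => x.
by rewrite !in_cnt => /asboolP hx; apply/asboolP; exact: h.
Qed.

Lemma cnt0 (P : T -> Prop) : (forall x, ~ P x) -> cnt P = 0%N.
Proof. by move=> h; apply: eq_card0 => x; rewrite in_cnt asboolF. Qed.

Lemma cnt_or (P P' : T -> Prop) : (cnt (fun x => P x \/ P' x) <= cnt P + cnt P')%N.
Proof.
rewrite -cardUI; apply: leq_trans (leq_addr _ _); apply: subset_leq_card.
apply/fintype.subsetP => x; rewrite in_cnt => /asboolP h; apply/orP.
by case: h => h; [left|right]; apply/asboolP.
Qed.

Lemma cnt_exists (I : finType) (P : I -> T -> Prop) :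
  (cnt (fun x => exists i, P i x) <= \sum_i cnt (P i))%N.
Proof.
rewrite /cnt -sum1_card.
rewrite (eq_bigr (fun i => \sum_x (`[< P i x >] : nat)))%N; last first.
  by move=> i _; rewrite -sum1_card big_mkcond /=; apply: eq_bigr => x _; rewrite in_cnt; case: asboolP.
rewrite exchange_big big_mkcond /=; apply: leq_sum => x _; rewrite in_cnt.
case: asboolP => // -[i Pi]; rewrite (bigD1 i) //= (leq_trans _ (leq_addr _ _)) //.
by case: asboolP.
Qed.

Lemma cnt_inj (f : T -> T) (P : T -> Prop) : injective f ->
  cnt (fun x => P (f x)) = cnt P.
Proof.
move=> fi; rewrite /cnt -!sum1_card [RHS](reindex_inj fi).
by [].
Qed.

End Counting.

(** * Nets for vectors that are nearly constant off few coordinates *)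

Section Net.
Variables (R : realType) (n d : nat).
Local Notation C := R[i].
Local Notation nc := (@Normc.normc R).
Implicit Types (pi : {ffun 'I_d -> 'S_n}) (u v w : 'I_n -> C) (Z : 'I_n -> 'I_n -> C).

(* The vector [(Ssum pi + Z) u], with vectors and matrices as plain functions. *)
Definition happ pi Z u i : C := \sum_(l < d) u (pi l i) + \sum_j Z i j * u j.

(** The negation is the structure to be excluded: some disc of radius [r] contains all but fewer
    than [k] coordinates. *)
Definition misses u (r : R) (k : nat) : Prop :=
  forall lam : C, (k <= #|[set j | (r < nc (u j - lam))%R]|)%N.

Lemma complex_grid (eps : R) : 0 < eps ->
  exists (g : nat) (pt : 'I_g * 'I_g -> C), g%:R <= 16 / eps + 1 /\
    forall z, nc z <= 4 -> exists a, nc (z - pt a) <= eps.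
Proof.
move=> e0; have e2 : 0 < eps / 2 by rewrite divr_gt0.
pose g := (Num.truncn (8 / (eps / 2))).+1.
pose c (a : 'I_g) : R := - 4 + eps / 2 * a%:R.
exists g, (fun a => Complex (c a.1) (c a.2)); split.
  rewrite /g -natr1 lerD2r (_ : 16 / eps = 8 / (eps / 2)); last by field; lra.
  by rewrite truncn_le divr_ge0 ?ltW.
have cov (x : R) : `|x| <= 4 -> exists a, `|x - c a| <= eps / 2.
  rewrite ler_norml => /andP[x1 x2].
  have q0 : 0 <= (x + 4) / (eps / 2) by apply: divr_ge0; [lra|exact: ltW].
  have ag : (Num.truncn ((x + 4) / (eps / 2)) < g)%N.
    by rewrite ltnS; apply: le_truncn; rewrite ler_pM2r ?invr_gt0 //; lra.
  exists (Ordinal ag); rewrite /c /=.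
  set t := Num.truncn _.
  have /andP[t1 t2] : t%:R <= (x + 4) / (eps / 2) < t.+1%:R by exact: truncn_itv.
  rewrite ler_pdivlMr // in t1; rewrite ltr_pdivrMr // -natr1 in t2.
  rewrite ler_norml; apply/andP; split; nra.
move=> z z4.
have [a ha] := cov _ (le_trans (Re_le_nc z) z4).
have [b hb] := cov _ (le_trans (Im_le_nc z) z4).
exists (a, b); apply: le_trans (nc_le_ReIm _) _.
rewrite raddfB raddfB /=; move: ha hb; lra.
Qed.

(** As the rows of [Z] sum to zero, the constant part [lam] of [u] contributes only [d lam]; so [u]
    may be approximated by a constant plus a sparse [w]. *)
Lemma happ_split pi Z u w (lam : C) i : (forall i, \sum_j Z i j = 0) ->
  happ pi Z u i = \sum_(l < d) w (pi l i) - (- (d%:R * lam) - \sum_j Z i j * w j)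
                  + happ pi Z (fun j => u j - lam - w j) i.
Proof.
move=> Z0; rewrite /happ.
have -> : \sum_(l < d) (u (pi l i) - lam - w (pi l i)) =
    \sum_(l < d) u (pi l i) - d%:R * lam - \sum_(l < d) w (pi l i).
  by rewrite !sumrB sumr_const card_ord mulr_natl.
have -> : \sum_j Z i j * (u j - lam - w j) =
    \sum_j Z i j * u j - \sum_j Z i j * w j.
  rewrite (eq_bigr (fun j => Z i j * u j - Z i j * lam - Z i j * w j)); last first.
    by move=> j _; ring.
  by rewrite !sumrB -mulr_suml Z0 mul0r subr0.
by ring.
Qed.

(** [K0] dominates the sum of the moduli in a row, that is, the operator norm for the sup norm. *)
Lemma happ_bound pi Z u (K K0 c : R) i :
  (forall i j, nc (Z i j) <= K) -> d%:R + n%:R * K <= K0 -> 0 <= c ->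
  (forall j, nc (u j) <= c) -> nc (happ pi Z u i) <= K0 * c.
Proof.
move=> ZK K0P c0 uc; apply: le_trans (ncD _ _) _.
apply: le_trans (ler_wpM2r c0 K0P); rewrite mulrDl; apply: lerD.
  apply: le_trans (nc_sum _ _ _) _.
  by rewrite (le_trans (ler_sum _ (fun l _ => uc _))) // sumr_const card_ord mulr_natl.
apply: le_trans (nc_sum _ _ _) _.
apply: (@le_trans _ _ (\sum_(j < n) K * c)).
  apply: ler_sum => j _; rewrite Normc.normcM ler_pM ?nc_ge0 //.
by rewrite sumr_const card_ord -mulrA mulr_natl.
Qed.

Definition structured Z (delta r r' : R) (k k' : nat) pi : Prop :=
  exists u, [/\ forall j, nc (u j) <= 1, forall i, nc (happ pi Z u i) <= delta,
                misses u r k & ~ misses u r' k'].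

(** Union bound over a rounded centre and [k'] pairs of a position and a rounded value. Rounding
    errs by at most [2 r'], which moves the image by [2 K0 r' = r / 4]. So [k] entries stay above
    [r - 2 r' >= 3 r / 4], while twice the tolerance [delta + r / 4] is below [3 r / 4]. *)
Lemma card_structured Z (K K0 r delta : R) (k k' N : nat) (G : finType) (pt : G -> C) :
  (forall i, \sum_j Z i j = 0) -> (forall i j, nc (Z i j) <= K) ->
  d%:R + n%:R * K <= K0 -> 1 <= K0 -> 0 < r <= 1 -> 0 <= delta < r / 8 ->
  (forall z, nc z <= 4 -> exists a, nc (z - pt a) <= r / (8 * K0)) ->
  (2 * k' <= n)%N -> (0 < k')%N -> (N <= d * k)%N -> (64 * N <= n)%N ->
  (cnt (structured Z delta r (r / (8 * K0)) k k') * 2 ^ N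
   <= #|G| * (n * #|G|) ^ k' * #|{ffun 'I_d -> 'S_n}|)%N.
Proof.
move=> Z0 ZK K0P K01 /andP[r0 r1] /andP[de0 der] cov kn k0 Nk Nn.
set r' := r / (8 * K0).
have K0pos : 0 < 8 * K0 by lra.
have r'0 : 0 < r' by rewrite divr_gt0.
have r'r : K0 * r' = r / 8 by rewrite /r'; field; lra.
have r'8 : r' <= r / 8 by rewrite -r'r ler_peMl // ltW.
pose wt (t : {ffun 'I_k' -> 'I_n * G}) j : C :=
  if [pick s | (t s).1 == j] is Some s then pt (t s).2 else 0.
pose A t := [set a | r - 2 * r' < nc (wt t a)].
pose tau := delta + 2 * K0 * r'.
pose y (a : G) t i : C := - (d%:R * pt a) - \sum_j Z i j * wt t j.
pose ok (x : G * {ffun 'I_k' -> 'I_n * G}) pi := (k <= #|A x.2|)%N /\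
  forall i, nc (\sum_(l < d) wt x.2 (pi l i) - y x.1 x.2 i) <= tau.
have cntok x : (cnt (ok x) * 2 ^ N <= #|{ffun 'I_d -> 'S_n}|)%N.
  case: (leqP k #|A x.2|) => [kA|Ak]; last first.
    by rewrite cnt0 // => pi []; rewrite leqNgt Ak.
  apply: leq_trans (@sparse_small_ball R n d (wt x.2) (y x.1 x.2) (r - 2 * r') tau
    (A x.2) N _ _ _ _ _).
  - rewrite leq_mul2r; apply/orP; right; apply: subset_leq_card.
    apply/fintype.subsetP => pi; rewrite in_cnt => /asboolP[_ h].
    by rewrite unfold_in /=; apply/forallP.
  - lra.
  - rewrite /tau; lra.
  - by move=> a; rewrite finset.in_set.
  - by rewrite (leq_trans Nk) // leq_mul2l kA orbT.
  - have : (#|~: [set j | wt x.2 j == 0%R]| <= k')%N.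
      rewrite -[X in (_ <= X)%N]card_ord.
      apply: leq_trans (leq_imset_card (fun s => (x.2 s).1) 'I_k').
      apply: subset_leq_card; apply/fintype.subsetP => j.
      rewrite finset.in_setC finset.in_set /wt; case: pickP => [s /eqP <- _|_]; last by rewrite eqxx.
      by apply/imsetP; exists s.
    have := cardsC [set j | wt x.2 j == 0]; rewrite card_ord.
    lia.
have sub pi : structured Z delta r r' k k' pi -> exists x, ok x pi.
  case=> u [u1 hu mu nmu].
  have [lam hl] : exists lam, (#|[set j | (r' < nc (u j - lam))%R]| < k')%N.
    apply: contra_notP nmu => h lam; rewrite leqNgt; apply/negP => h'.
    by apply: h; exists lam.
  set E := [set j | _] in hl.
  (* A coordinate inside the disc bounds its centre by 2, so everything to be rounded has modulus at
     most 4, the range of the net. *)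
  have [j0 j0E] : exists j0, j0 \notin E.
    apply/existsP; rewrite -negb_forall; apply/negP => /forallP h.
    have : E = [set: 'I_n]%SET by apply/setP => j; rewrite finset.in_setT h.
    move=> ET; move: hl; rewrite ET finset.cardsT card_ord; lia.
  have lam2 : nc lam <= 2.
    have := j0E; rewrite finset.in_set -leNgt => h.
    rewrite (_ : lam = u j0 - (u j0 - lam)); last by ring.
    have := u1 j0; have := ncB (u j0) (u j0 - lam); lra.
  have [a ha] : exists a, nc (lam - pt a) <= r' by apply: cov; lra.
  have near j : exists b, nc (u j - pt a - pt b) <= r'.
    apply: cov.
    rewrite (_ : u j - pt a = u j + ((lam - pt a) - lam)); last by ring.
    have := ncD (u j) ((lam - pt a) - lam); have := ncB (lam - pt a) lam.
    have := u1 j; lra.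
  (* Slots beyond the size of [E] repeat [j0]; this is harmless, since [j0] gets its own rounded
     value too. *)
  pose e (s : 'I_k') : 'I_n := nth j0 (enum E) s.
  pose t := [ffun s => (e s, sval (cid (near (e s))))].
  have err j : nc (u j - pt a - wt t j) <= 2 * r'.
    rewrite /wt; case: pickP => [s|hs].
      rewrite /t ffunE /= => /eqP <-; have := svalP (cid (near (e s))); lra.
    have jE : j \notin E.
      apply/negP => jE; have js : (index j (enum E) < k')%N.
        by rewrite (leq_trans _ hl) // ltnS cardE index_size.
      have := hs (Ordinal js); rewrite /t ffunE /= /e /= nth_index ?mem_enum //.
      by rewrite eqxx.
    move: jE; rewrite finset.in_set -leNgt => h; rewrite subr0.
    rewrite (_ : u j - pt a = (u j - lam) + (lam - pt a)); last by ring.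
    by rewrite (le_trans (ncD _ _)) //; lra.
  exists (a, t); split => /=.
    apply: leq_trans (mu (pt a)) _; apply: subset_leq_card; apply/fintype.subsetP => j.
    rewrite !finset.in_set => h.
    have := ncD (wt t j) (u j - pt a - wt t j).
    rewrite (_ : wt t j + _ = u j - pt a); last by ring.
    have := err j; lra.
  move=> i; have := hu i; rewrite (happ_split pi u (wt t) (pt a) i Z0) => h.
  have hb := happ_bound pi i ZK K0P (ltW (mulr_gt0 (ltr0Sn R 1) r'0)) err.
  set Y := happ pi Z _ i in h hb *; set X := (X in nc (X + Y)) in h.
  rewrite -/X (_ : X = (X + Y) - Y); last by ring.
  have := ncB (X + Y) Y; rewrite /tau; lra.
apply: (@leq_trans (\sum_x cnt (ok x) * 2 ^ N)%N).
  by rewrite -big_distrl leq_mul2r (leq_trans (cnt_le sub)) ?orbT // cnt_exists.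
apply: leq_trans (leq_sum _ (fun x _ => cntok x)) _.
by rewrite sum_nat_const card_prod card_ffun card_prod !card_ord.
Qed.

End Net.

(** * Iteration over the levels *)

Section Levels.
Variables (R : realType) (n d : nat).
Local Notation C := R[i].
Local Notation nc := (@Normc.normc R).
Implicit Types (pi : {ffun 'I_d -> 'S_n}) (u v w : 'I_n -> C) (Z : 'I_n -> 'I_n -> C).

Lemma sum_happ pi Z u : (forall j, \sum_i Z i j = 0) ->
  \sum_i happ pi Z u i = d%:R * \sum_j u j.
Proof.
move=> Z0; rewrite /happ big_split /= exchange_big /=.
rewrite (eq_bigr (fun l => \sum_j u j)); last first.
  by move=> l _; rewrite [RHS](reindex_inj (@perm_inj _ (pi l))).
rewrite sumr_const card_ord [RHS]mulr_natl exchange_big /= [X in _ + X]big1 ?addr0 //.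
by move=> j _; rewrite -mulr_suml Z0 mul0r.
Qed.

(** Summing all rows removes [Z], so the mean of [u] has modulus at most [delta]. If all coordinates
    were within [1 / 4] of [lam], then [lam] would be at most [delta + 1 / 4] in modulus, too small
    for a coordinate of modulus 1. *)
Lemma misses_base pi Z u (delta : R) : (0 < d)%N ->
  (forall j, \sum_i Z i j = 0) -> (exists j, nc (u j) = 1) -> delta < 1 / 2 ->
  (forall i, nc (happ pi Z u i) <= delta) -> misses u (1 / 4) 1.
Proof.
move=> d0 Z0 [j0 uj0] de hu lam; rewrite lt0n; apply/negP => /eqP/cards0_eq h.
have hall j : nc (u j - lam) <= 1 / 4.
  by rewrite leNgt; apply/negP => hj; move/setP/(_ j): h; rewrite finset.in_set hj finset.in_set0.
have n0 : (0 < n%:R :> R) by rewrite ltr0n (leq_ltn_trans _ (ltn_ord j0)).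
have s1 : nc (\sum_j u j) <= n%:R * delta.
  have : nc (d%:R * \sum_j u j) <= n%:R * delta.
    rewrite -(sum_happ pi u Z0); apply: le_trans (nc_sum _ _ _) _.
    by rewrite (le_trans (ler_sum _ (fun i _ => hu i))) // sumr_const card_ord mulr_natl.
  apply: le_trans; rewrite Normc.normcM ler_peMl ?nc_ge0 //.
  by rewrite nc_nat ler1n.
have s2 : nc (\sum_j (u j - lam)) <= n%:R * (1 / 4).
  apply: le_trans (nc_sum _ _ _) _.
  by rewrite (le_trans (ler_sum _ (fun i _ => hall i))) // sumr_const card_ord mulr_natl.
have s3 : nc (n%:R * lam) = n%:R * nc lam by rewrite Normc.normcM nc_nat.
have s4 : nc (n%:R * lam) <= n%:R * delta + n%:R * (1 / 4).
  rewrite (_ : n%:R * lam = \sum_j u j - \sum_j (u j - lam)); last first.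
    by rewrite sumrB sumr_const card_ord mulr_natl opprB addrC subrK.
  by rewrite (le_trans (ncB _ _)) // lerD.
have s5 : nc lam <= delta + 1 / 4.
  by rewrite -(ler_pM2l n0) -s3 mulrDr.
have := ncD (u j0 - lam) lam; rewrite subrK uj0; have := hall j0; lra.
Qed.

(** The start [1 / 4] is the radius of [misses_base]; each level loses the factor [8 K0] of
    [card_structured]. *)
Definition level_radius (K0 : R) (j : nat) : R := (1 / 4) / (8 * K0) ^+ j.

Lemma level_radiusS K0 j : level_radius K0 j.+1 = level_radius K0 j / (8 * K0).
Proof. by rewrite /level_radius exprSr invfM mulrA. Qed.

Lemma level_radius_le K0 i j : 1 <= K0 -> (i <= j)%N ->
  level_radius K0 j <= level_radius K0 i.
Proof.
move=> K1 ij; rewrite /level_radius ler_pM2l; last by lra.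
have p k : 0 < (8 * K0) ^+ k by rewrite exprn_gt0 //; lra.
by rewrite lef_pV2 ?posrE // ler_weXn2l //; lra.
Qed.

Lemma level_radius_gt0 K0 j : 1 <= K0 -> 0 < level_radius K0 j.
Proof.
by move=> K1; rewrite /level_radius divr_gt0 ?exprn_gt0 //; lra.
Qed.

Definition structured_null Z (delta r : R) (h : nat) pi : Prop :=
  exists u, [/\ forall j, nc (u j) <= 1, exists j, nc (u j) = 1,
    forall i, nc (happ pi Z u i) <= delta & ~ misses u r h].

(** The number of exceptional coordinates is at least 1 at level 0; if it has not reached [h] at
    level [m], it fails at some level to grow from [q ^ j] to [q ^ (j + 1)]. There the small-ball
    bound with [N = 4 b k'] beats a net of at most [2 ^ (b (k' + 1)) <= 2 ^ (2 b k')] points and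
    leaves at least [2 ^ (2 b)]. *)
Lemma card_structured_null Z (K K0 delta : R) (m q h b : nat) (G : finType) (pt : G -> C) :
  (0 < d)%N -> (0 < q)%N -> (0 < h)%N -> (0 < b)%N -> (h <= q ^ m)%N ->
  (forall i, \sum_j Z i j = 0) -> (forall j, \sum_i Z i j = 0) ->
  (forall i j, nc (Z i j) <= K) -> d%:R + n%:R * K <= K0 -> 1 <= K0 ->
  0 <= delta < level_radius K0 m / 8 ->
  (forall z, nc z <= 4 -> exists a, nc (z - pt a) <= level_radius K0 m) ->
  (n * #|G| <= 2 ^ b)%N -> (4 * b * q <= d)%N -> (256 * b * h <= n)%N ->
  (cnt (structured_null Z delta (level_radius K0 m) h) * 2 ^ (2 * b)
     <= m * #|{ffun 'I_d -> 'S_n}|)%N.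
Proof.
move=> d0 q0 h0 b0 hq Zr Zc ZK K0P K01 /andP[de0 dem] cov nG bq bh.
(* The cap keeps [256 b k' <= n] at every level, and [h <= q ^ m] makes the last level reach [h]
   exactly. *)
pose kap j := minn (q ^ j) h.
pose ev j : {ffun 'I_d -> 'S_n} -> Prop := structured Z delta (level_radius K0 j) (level_radius K0 j.+1) (kap j) (kap j.+1).
have rpos j := level_radius_gt0 j K01.
have sub pi : structured_null Z delta (level_radius K0 m) h pi ->
    exists j : 'I_m, ev j pi.
  case=> u [u1 uj hu nm]; apply: contrapT => nev; apply: nm.
  suff : misses u (level_radius K0 m) (kap m) by rewrite /kap (minn_idPr hq).
  have : (m <= m)%N by [].
  elim: {-2}m => [_|j IH jm].
    rewrite /level_radius expr0 invr1 mulr1 => lam.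
    rewrite (leq_trans (geq_minl _ _)) // expn0.
    apply: (misses_base d0 Zc uj _ hu); move: dem.
    have := level_radius_le K01 (leq0n m); rewrite /level_radius expr0 invr1 mulr1; lra.
  apply: contrapT => nmj; apply: nev; exists (Ordinal jm); exists u; split => //.
  exact/IH/ltnW.
have each j : (j < m)%N -> (cnt (ev j) * 2 ^ (2 * b) <= #|{ffun 'I_d -> 'S_n}|)%N.
  move=> jm; set k' := kap j.+1.
  have k'0 : (0 < k')%N by rewrite /k' /kap leq_min expn_gt0 q0 h0.
  have k'h : (k' <= h)%N by exact: geq_minr.
  have k'q : (k' <= q * kap j)%N.
    rewrite /k' /kap minnMr -expnS leq_min geq_minl /= (leq_trans (geq_minr _ _)) //.
    exact: leq_pmull.
  have bh' : (256 * b * k' <= n)%N by rewrite (leq_trans _ bh) // leq_mul2l k'h orbT.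
  have := @card_structured R n d Z K K0 (level_radius K0 j) delta (kap j) k' (4 * b * k')
     G pt Zr ZK K0P K01.
  rewrite -level_radiusS -/(ev j) => /(_ _ _ _ _ k'0).
  have rr : 0 < level_radius K0 j <= 1.
    rewrite rpos /=; have := level_radius_le K01 (leq0n j).
    rewrite [in X in _ <= X]/level_radius expr0 invr1 mulr1; lra.
  have dd : 0 <= delta < level_radius K0 j / 8.
    by rewrite de0 /=; have := level_radius_le K01 (ltnW jm); lra.
  have cov' z : nc z <= 4 -> exists a, nc (z - pt a) <= level_radius K0 j.+1.
    by move/cov=> [a ha]; exists a; exact: le_trans ha (level_radius_le K01 jm).
  move=> /(_ rr dd cov').
  have e1 : (2 * k' <= n)%N by nia.
  have e2 : (4 * b * k' <= d * kap j)%N.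
    rewrite (leq_trans (leq_mul (leqnn _) k'q)) // mulnA.
    by rewrite leq_mul2r bq orbT.
  have e3 : (64 * (4 * b * k') <= n)%N by rewrite !mulnA.
  move=> /(_ e1 e2 e3) H.
  have G1 : (#|G| * (n * #|G|) ^ k' <= 2 ^ (2 * b * k'))%N.
    apply: (@leq_trans ((n * #|G|) ^ k'.+1)).
      by rewrite expnS leq_mul2r leq_pmull ?orbT // (leq_trans _ e1) // muln_gt0.
    apply: (@leq_trans ((2 ^ b) ^ k'.+1)); first by rewrite leq_exp2r.
    by rewrite -expnM leq_exp2l //; nia.
  have H2 : (cnt (ev j) * 2 ^ (2 * b * k') <= #|{ffun 'I_d -> 'S_n}|)%N.
    have := leq_trans H (leq_mul G1 (leqnn _)).
    rewrite (_ : 4 * b * k' = 2 * b * k' + 2 * b * k')%N; last by lia.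
    by rewrite expnD mulnA mulnC leq_pmul2l // expn_gt0.
  apply: leq_trans H2; rewrite leq_mul2l leq_exp2l // leq_pmulr ?orbT //.
apply: (@leq_trans (\sum_(j < m) cnt (ev j) * 2 ^ (2 * b))%N).
  by rewrite -big_distrl leq_mul2r (leq_trans (cnt_le sub)) ?orbT // cnt_exists.
apply: (@leq_trans (\sum_(j < m) #|{ffun 'I_d -> 'S_n}|)%N).
  by apply: leq_sum => j _; exact: each.
by rewrite sum_nat_const card_ord.
Qed.

End Levels.

(** * Spread vectors and mixing of permutations *)

Section Spread.
Variables (R : realType) (n : nat).
Local Notation C := R[i].
Local Notation nc := (@Normc.normc R).

Definition spread (f : 'I_n -> R) (s : R) (a : nat) : Prop :=
  exists A B : {set 'I_n}, [/\ (a <= #|A|)%N, (n <= 2 * #|B|)%N &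
    forall x y, x \in A -> y \in B -> s <= `|f x - f y|].

(** [mu] is the least value with half of the coordinates at or below it. If fewer than half were at
    or above it, the largest value below [mu] would have the same property. *)
Lemma median (f : 'I_n -> R) : (0 < n)%N -> exists mu : R,
  (n <= 2 * #|[set j | (f j <= mu)%R]|)%N /\ (n <= 2 * #|[set j | (mu <= f j)%R]|)%N.
Proof.
case: n f => // n' f _.
pose P i := (n'.+1 <= 2 * #|[set j | (f j <= f i)%R]|)%N.
have Pmax : P [arg max_(i > ord0) f i]%O.
  case: arg_maxP => // i _ hi; rewrite /P (_ : finset _ = [set: 'I_n'.+1]%SET).
    by rewrite finset.cardsT card_ord leq_pmull.
  by apply/setP => j; rewrite finset.in_set finset.in_setT; apply: hi.
exists (f [arg min_(i < [arg max_(i > ord0) f i]%O | P i) f i]%O).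
case: arg_minP => // i Pi hi; split => //.
set U := [set j | _ <= f j]%R.
rewrite leqNgt; apply/negP => hlt.
have UC : (n'.+1 < 2 * #|~: U|)%N by have := cardsC U; rewrite card_ord; lia.
have [j1 j1U] : exists j1, j1 \in ~: U.
  by apply/card_gt0P; lia.
pose j2 := [arg max_(j > j1 in ~: U) f j]%O.
have [j2U hj2] : j2 \in ~: U /\ forall j, j \in ~: U -> f j <= f j2.
  by rewrite /j2; case: arg_maxP.
have Pj2 : P j2.
  apply: leq_trans (ltnW UC) _; rewrite leq_mul2l /=; apply: subset_leq_card.
  by apply/fintype.subsetP => j jU; rewrite finset.in_set; exact: hj2.
have := hi _ Pj2; move: j2U; rewrite finset.in_setC finset.in_set => /negP h1 h2.
by apply: h1.
Qed.

(** Of the [2 a] coordinates far from the median, [a] lie on one side; they are far from the half of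
    all coordinates on the other side. *)
Lemma spread_real (f : 'I_n -> R) (s : R) (a : nat) : (0 < n)%N -> 0 <= s ->
  (forall lam : R, (2 * a <= #|[set j | (s < `|f j - lam|)%R]|)%N) -> spread f s a.
Proof.
move=> n0 s0 h; have [mu [h1 h2]] := median f n0.
set U := [set j | (mu + s < f j)%R]; set V := [set j | (f j < mu - s)%R].
have : (2 * a <= #|U| + #|V|)%N.
  apply: leq_trans (h mu) _; apply: leq_trans (leq_card_setU _ _).
  apply: subset_leq_card; apply/fintype.subsetP => j.
  rewrite finset.in_setU !finset.in_set lter_normr => /orP[] h'; apply/orP; [left|right]; lra.
move=> UV; have : (a <= #|U|)%N || (a <= #|V|)%N by lia.
case/orP => ha; [exists U, [set j | (f j <= mu)%R] | exists V, [set j | (mu <= f j)%R]].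
  split=> // x y; rewrite !finset.in_set => hx hy.
  by rewrite ler_normr; apply/orP; left; lra.
split=> // x y; rewrite !finset.in_set => hx hy.
by rewrite ler_normr; apply/orP; right; lra.
Qed.

(** If both parts had a centre with fewer than [2 a] exceptions, the two centres would form a
    complex centre with fewer than [4 a] exceptions at radius [r]. *)
Lemma misses_spread (u : 'I_n -> C) (r : R) (h a : nat) : (0 < n)%N -> 0 <= r ->
  (4 * a <= h)%N -> misses u r h ->
  spread (fun j => complex.Re (u j)) (r / 2) a \/ spread (fun j => complex.Im (u j)) (r / 2) a.
Proof.
move=> n0 r0 ah mu.
have r2 : 0 <= r / 2 by lra.
case: (pselect (spread (fun j => complex.Re (u j)) (r / 2) a)) => [|nR]; first by left.
right; apply: contrapT => nI.
have ex (f : 'I_n -> R) : ~ spread f (r / 2) a ->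
    exists lam : R, (#|[set j | (r / 2 < `|f j - lam|)%R]| < 2 * a)%N.
  move=> nf; apply: contrapT => h'; apply: nf; apply: spread_real => // lam.
  by rewrite leqNgt; apply/negP => h2; apply: h'; exists lam.
have [l1 h1] := ex _ nR; have [l2 h2] := ex _ nI.
have := mu (Complex l1 l2); apply/negP; rewrite -ltnNge.
apply: leq_trans ah.
apply: (@leq_ltn_trans (#|[set j | (r / 2 < `|complex.Re (u j) - l1|)%R]| +
   #|[set j | (r / 2 < `|complex.Im (u j) - l2|)%R]|)); last by lia.
apply: leq_trans (leq_card_setU _ _); apply: subset_leq_card.
apply/fintype.subsetP => j; rewrite finset.in_setU !finset.in_set.
apply: contraTT; rewrite negb_or -!leNgt => /andP[g1 g2].
apply: le_trans (nc_le_ReIm _) _; rewrite !raddfB /=; lra.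
Qed.

End Spread.

(** * Lower tail for the number of hits of a random permutation *)

Section LowerTail.
Variables (R : realType) (n : nat).

Let hits (A : {set 'I_n}) (s : seq 'I_n) (f : 'S_n) := count (fun i => f i \in A) s.
Let wt A t s f : R := if (hits A s f < t)%N then 2^-1 ^+ hits A s f else 0.

(* Composing with a transposition [tperm i b], where [b] avoids the rows already
   inspected, makes the image of [i] uniform over the unused values. *)
Let sum_wt (A : {set 'I_n}) t s : (2 * t <= #|A|)%N -> uniq s ->
  \sum_(f : 'S_n) wt A t s f <= (1 - #|A|%:R / (4 * n%:R)) ^+ size s * #|'S_n|%:R.
Proof.
move=> tA; elim: s => [_|i s IH /andP[iS uS]].
  rewrite expr0 mul1r -sum1_card natr_sum; apply: ler_sum => f _.
  by rewrite /wt /hits /=; case: ifP.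
have n0 : (0 < n)%N by exact: leq_ltn_trans (ltn_ord i).
have n0R : 0 < n%:R :> R by rewrite ltr0n.
have An : (#|A| <= n)%N by rewrite -[X in (_ <= X)%N]card_ord max_card.
have c0 : 0 <= 1 - #|A|%:R / (4 * n%:R) :> R.
  rewrite subr_ge0 ler_pdivrMr; last by lra.
  have : #|A|%:R <= n%:R :> R by rewrite ler_nat.
  by move: n0R; lra.
apply: (@le_trans _ _ ((1 - #|A|%:R / (4 * n%:R)) * \sum_(f : 'S_n) wt A t s f)); last first.
  by rewrite exprS -mulrA ler_wpM2l // IH.
pose B := [set b | b \notin s].
have iB : i \in B by rewrite finset.in_set.
have B0 : 0 < #|B|%:R :> R by rewrite ltr0n; apply/card_gt0P; exists i.
have Bn : (#|B| <= n)%N by rewrite -[X in (_ <= X)%N]card_ord max_card.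
rewrite -(ler_pM2l B0) -sum1_card natr_sum mulr_suml.
rewrite (eq_bigr (fun b => \sum_(f : 'S_n) wt A t (i :: s) (tperm i b * f)%g)); last first.
  move=> b _; rewrite mul1r (reindex_inj (mulgI (tperm i b))) //.
rewrite exchange_big /= -natr_sum sum1_card mulrA mulr_sumr; apply: ler_sum => f _.
have hitsE b : b \in B ->
    hits A (i :: s) (tperm i b * f)%g = ((f b \in A) + hits A s f)%N.
  rewrite finset.in_set => bs; rewrite /hits /= permM tpermL; congr (_ + _)%N.
  apply: eq_in_count => j js; rewrite permM tpermD //.
    by apply: contraNneq iS => ->.
  by apply: contraNneq bs => ->.
rewrite {2}/wt; case: ifP => [ht|/negbT hge]; last first.
  rewrite mulr0 big1 // => b bB; rewrite /wt hitsE //; case: ifP => // h.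
  by move: hge; rewrite (leq_trans _ h) // ltnS leq_addl.
apply: (@le_trans _ _ (\sum_(b in B) (1 - (f b \in A)%:R / 2) * 2^-1 ^+ hits A s f)).
  apply: ler_sum => b bB; rewrite /wt hitsE //.
  have p0 : 0 <= (2^-1 : R) ^+ hits A s f by rewrite exprn_ge0 // invr_ge0.
  case: (f b \in A) => /=.
    rewrite add1n exprS; case: ifP => _; first by rewrite ler_wpM2r //; lra.
    by rewrite mulr_ge0 //; lra.
  by rewrite add0n ht mul0r subr0 mul1r.
rewrite -mulr_suml ler_wpM2r ?exprn_ge0 ?invr_ge0 //.
rewrite big_split /= sumr_const sumrN -mulr_suml -natr_sum.
have cB : (#|A| = \sum_(b in B) (f b \in A) + hits A s f)%N.
  rewrite -(card_preimset A (@perm_inj _ f)) -sum1_card.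
  rewrite (bigID (mem B)) /=; congr (_ + _)%N.
    rewrite big_mkcond [RHS]big_mkcond /=; apply: eq_bigr => b _.
    by rewrite finset.in_set finset.in_set; case: (b \in s); rewrite /= ?andbF ?andbT //; case: (f b \in A).
  rewrite /hits -size_filter -(card_uniqP (filter_uniq _ uS)) -sum1_card.
  apply: eq_bigl => b; rewrite mem_filter !finset.in_set negbK.
  by [].
have : (#|A| <= 2 * \sum_(b in B) (f b \in A))%N by move: cB ht tA; lia.
set x := (\sum_(b in B) _)%N; rewrite -(ler_nat R) natrM => xA.
rewrite mulrBr mulr1 lerD2l lerN2.
apply: (@le_trans _ _ (#|A|%:R / 4)); last by move: xA; lra.
rewrite mulrA ler_pdivrMr; last by lra.
have : (#|B|%:R <= n%:R :> R) by rewrite ler_nat.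
have : 0 <= #|A|%:R :> R by [].
by move: n0R; nra.
Qed.

(** Markov's inequality: below [t] hits the weight is at least [2 ^ -t], and its mean is at most
    [exp (- 2 x)] for [x = |A| |A'| / (8 n)]. The loss [2 ^ t <= exp x] consumes half of the
    exponent. *)
Lemma perm_lower_tail (A A' : {set 'I_n}) (t : nat) :
  t%:R <= #|A|%:R * #|A'|%:R / (8 * n%:R) :> R ->
  #|[pred f : 'S_n | (#|[set i in A' | f i \in A]| < t)%N]|%:R
    <= expR (- (#|A|%:R * #|A'|%:R / (8 * n%:R))) * #|'S_n|%:R :> R.
Proof.
move=> ht; set x : R := #|A|%:R * _ / _ in ht *.
(* For [n = 0] the exponent is a division by zero, hence 0, and the bound is trivial. *)
case: (posnP n) => [n0|n0].
  have nR0 : n%:R = 0 :> R by rewrite n0.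
  have x0 : x = 0 by rewrite /x nR0 mulr0 invr0 mulr0.
  rewrite x0 oppr0 expR0 mul1r ler_nat max_card //.
have n0R : 0 < n%:R :> R by rewrite ltr0n.
have A'n : #|A'|%:R <= n%:R :> R by rewrite ler_nat -[X in (_ <= X)%N]card_ord max_card.
have An : #|A|%:R <= n%:R :> R by rewrite ler_nat -[X in (_ <= X)%N]card_ord max_card.
have tA : (2 * t <= #|A|)%N.
  rewrite -(ler_nat R) natrM; apply: le_trans (ler_wpM2l _ ht) _ => //.
  rewrite /x mulrA ler_pdivrMr; last by lra.
  have : 0 <= #|A|%:R :> R by []. 
  by move: A'n n0R; nra.
have := sum_wt tA (enum_uniq A'); rewrite -cardE => H.
have h1 : #|[pred f : 'S_n | (#|[set i in A' | f i \in A]| < t)%N]|%:R * 2^-1 ^+ t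
    <= \sum_(f : 'S_n) wt A t (enum A') f.
  rewrite -sum1_card natr_sum mulr_suml big_mkcond /=; apply: ler_sum => f _.
  have hE : hits A (enum A') f = #|[set i in A' | f i \in A]|.
    rewrite /hits -size_filter -(card_uniqP (filter_uniq _ (enum_uniq A'))).
    by apply: eq_card => j; rewrite mem_filter mem_enum finset.in_set andbC.
  rewrite unfold_in /= /wt hE; case: ifP => // hlt.
  by rewrite mul1r; apply: ler_wiXn2l; [lra|lra|exact: ltnW].
have h2 : (1 - #|A|%:R / (4 * n%:R)) ^+ #|A'| <= expR (- (2 * x)) :> R.
  rewrite (_ : - (2 * x) = #|A'|%:R * - (#|A|%:R / (4 * n%:R))); last first.
    rewrite /x; field; lra.
  rewrite expRM_natl lerXn2r ?nnegrE ?expR_ge0 //; last exact: expR_ge1Dx.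
  rewrite subr_ge0 ler_pdivrMr; last by lra.
  by move: An n0R; lra.
have h3 : 2 ^+ t <= expR x :> R.
  apply: le_trans (_ : expR t%:R <= _); last by rewrite ler_expR.
  rewrite -[t%:R]mulr1 expRM_natl lerXn2r ?nnegrE ?expR_ge0 //.
  by have := expR_ge1Dx (1 : R); lra.
have h4 := le_trans h1 (le_trans H (ler_wpM2r (ler0n _ _) h2)).
have p2 : 0 < 2 ^+ t :> R by rewrite exprn_gt0.
rewrite exprVn ler_pdivrMr // in h4; apply: le_trans h4 _.
rewrite mulrAC ler_wpM2r //; apply: le_trans (ler_wpM2l (expR_ge0 _) h3) _.
by rewrite -expRD (_ : - (2 * x) + x = - x) //; ring.
Qed.

End LowerTail.

(** * Overlaps, uniformly over all sets *)

Section Discrepancy.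
Variables (R : realType) (n d : nat).
Implicit Types (pi : {ffun 'I_d -> 'S_n}).

(** Markov's inequality for a product of independent factors, [x ^ -2] at a bad permutation and 1
    otherwise: each has mean at most 2, and with half of them bad the product is at least
    [x ^ -d]. *)
Lemma card_many_bad (bad : pred 'S_n) (x : R) : 0 < x <= 1 ->
  #|bad|%:R <= x ^+ 2 * #|'S_n|%:R :> R ->
  #|[pred pi : {ffun 'I_d -> 'S_n} | (d <= 2 * #|[pred l | bad (pi l)]|)%N]|%:R
    <= (2 * x) ^+ d * #|{ffun 'I_d -> 'S_n}|%:R :> R.
Proof.
move=> /andP[x0 x1] hbad.
pose w (s : 'S_n) : R := if bad s then x^-2 else 1.
have w0 s : 0 <= w s by rewrite /w; case: ifP => // _; rewrite invr_ge0 exprn_ge0 // ltW.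
have x20 : 0 < x ^+ 2 by rewrite exprn_gt0.
have sumw : \sum_s w s <= 2 * #|'S_n|%:R.
  rewrite (bigID bad) /= mulrDl mul1r; apply: lerD.
    rewrite (eq_bigr (fun=> x^-2)); last by move=> s; rewrite /w => ->.
    by rewrite sumr_const -(mulr_natr (x^-2)) ler_pdivrMl.
  rewrite (eq_bigr (fun=> 1)); last by move=> s; rewrite /w => /negPf ->.
  by rewrite sumr_const ler_nat max_card.
have prodw : \sum_(pi : {ffun 'I_d -> 'S_n}) \prod_(l < d) w (pi l) = (\sum_s w s) ^+ d.
  by rewrite -(bigA_distr_bigA (fun _ : 'I_d => w)) /= prodr_const card_ord.
have h : #|[pred pi : {ffun 'I_d -> 'S_n} | (d <= 2 * #|[pred l | bad (pi l)]|)%N]|%:R * x ^- d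
    <= \sum_(pi : {ffun 'I_d -> 'S_n}) \prod_(l < d) w (pi l).
  rewrite -sum1_card natr_sum mulr_suml big_mkcond /=; apply: ler_sum => pi _.
  case: ifP => [|_]; last by rewrite prodr_ge0.
  rewrite unfold_in /= => hd; rewrite mul1r.
  rewrite (_ : \prod_(l < d) _ = x^-1 ^+ (2 * #|[pred l | bad (pi l)]|)); last first.
    rewrite exprM exprVn (bigID (fun l => bad (pi l))) /=.
    rewrite [X in _ * X]big1 ?mulr1; last by move=> l; rewrite /w => /negPf ->.
    rewrite (eq_bigr (fun=> x^-2)); last by move=> l; rewrite /w => ->.
    by rewrite prodr_const.
  by rewrite -exprVn ler_weXn2l // invf_ge1.
have xd : 0 < x ^+ d by rewrite exprn_gt0.
rewrite prodw ler_pdivrMr // in h; apply: le_trans h _.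
rewrite card_ffun card_ord natrX -!exprMn lerXn2r ?nnegrE //.
- by rewrite mulr_ge0 ?sumr_ge0 // ltW.
- by rewrite !mulr_ge0 // ltW.
- by rewrite mulrAC ler_wpM2r // ltW.
Qed.

Definition overlap pi (A A' B B' : {set 'I_n}) : nat :=
  (\sum_(l < d) #|[set i in A' | pi l i \in A]| * #|[set i in B' | pi l i \in B]|)%N.

Definition low_overlap (a t1 t2 : nat) pi : Prop :=
  exists A A' B B' : {set 'I_n},
    [/\ (a <= #|A|)%N, (a <= #|A'|)%N, (n <= 2 * #|B|)%N, (n <= 2 * #|B'|)%N &
        (2 * overlap pi A A' B B' < d * (t1 * t2))%N].

(** For fixed sets one permutation fails with probability at most [2 exp (- sigma) <= x ^ 2], where
    [x = exp (- sigma / 4)], so half of them do with probability at most [(2 x) ^ d <= exp (- d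
    sigma / 8) <= exp (- 5 n)]. The union over [2 ^ (4 n)] quadruples of sets costs at most
    [exp (4 n)]. *)
Lemma card_low_overlap (a t1 t2 : nat) (sigma : R) :
  (0 < n)%N -> (2 * a <= n)%N -> sigma = a%:R ^+ 2 / (8 * n%:R) ->
  8 <= sigma -> 40 * n%:R <= d%:R * sigma ->
  t1%:R <= sigma -> t2%:R <= n%:R / 32 :> R ->
  (cnt (low_overlap a t1 t2))%:R <= expR (- n%:R) * #|{ffun 'I_d -> 'S_n}|%:R :> R.
Proof.
move=> n0 an sE s8 sd ht1 ht2.
have n0R : 0 < n%:R :> R by rewrite ltr0n.
pose x : R := expR (- (sigma / 4)).
have x01 : 0 < x <= 1 by rewrite expR_gt0 expR_le1; lra.
have fixd (q : {set 'I_n} * {set 'I_n} * {set 'I_n} * {set 'I_n}) :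
   (cnt (fun pi : {ffun 'I_d -> 'S_n} => let: (A, A', B, B') := q in
     [/\ (a <= #|A|)%N, (a <= #|A'|)%N, (n <= 2 * #|B|)%N, (n <= 2 * #|B'|)%N &
        (2 * overlap pi A A' B B' < d * (t1 * t2))%N]))%:R
     <= (2 * x) ^+ d * #|{ffun 'I_d -> 'S_n}|%:R :> R.
  case: q => [[[A A'] B] B'].
  pose bad (s : 'S_n) := (#|[set i in A' | s i \in A]| < t1)%N ||
                         (#|[set i in B' | s i \in B]| < t2)%N.
  case: (pselect [/\ (a <= #|A|)%N, (a <= #|A'|)%N, (n <= 2 * #|B|)%N & (n <= 2 * #|B'|)%N]);
    last first.
    move=> no; rewrite cnt0; last by move=> pi [h1 h2 h3 h4 _]; apply: no.
    rewrite mulr_ge0 // exprn_ge0 // mulr_ge0 // expR_ge0 //.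
  case=> aA aA' nB nB'.
  have hbad : #|bad|%:R <= x ^+ 2 * #|'S_n|%:R :> R.
    have e1 : sigma <= #|A|%:R * #|A'|%:R / (8 * n%:R).
      rewrite sE ler_pM2r ?invr_gt0; last by lra.
      by rewrite expr2 ler_pM // ler_nat.
    have e2 : sigma <= #|B|%:R * #|B'|%:R / (8 * n%:R) /\
              n%:R / 32 <= #|B|%:R * #|B'|%:R / (8 * n%:R) :> R.
      have c1 : n%:R / 2 <= #|B|%:R :> R.
        by rewrite ler_pdivrMr // mulrC -natrM ler_nat.
      have c2 : n%:R / 2 <= #|B'|%:R :> R.
        by rewrite ler_pdivrMr // mulrC -natrM ler_nat.
      have c3 : a%:R <= n%:R / 2 :> R by rewrite ler_pdivlMr // mulrC -natrM ler_nat.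
      have c4 : (n%:R / 2) * (n%:R / 2) <= #|B|%:R * #|B'|%:R :> R.
        by rewrite ler_pM // divr_ge0.
      have c5 : a%:R ^+ 2 <= (n%:R / 2) * (n%:R / 2) :> R.
        by rewrite expr2 ler_pM.
      split.
        rewrite sE ler_pM2r ?invr_gt0; last by lra.
        exact: le_trans c5 c4.
      rewrite ler_pdivlMr; last by lra.
      by apply: le_trans c4; rewrite -subr_ge0; nra.
    have l1 := perm_lower_tail (le_trans ht1 e1).
    have l2 := perm_lower_tail (le_trans ht2 (proj2 e2)).
    have S0 : 0 <= #|'S_n|%:R :> R by [].
    apply: (@le_trans _ _ ((expR (- sigma) + expR (- sigma)) * #|'S_n|%:R)).
      apply: (@le_trans _ _ (#|[pred f : 'S_n | (#|[set i in A' | f i \in A]| < t1)%N]|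
           + #|[pred f : 'S_n | (#|[set i in B' | f i \in B]| < t2)%N]|)%:R).
        rewrite ler_nat -cardUI; apply: leq_trans (leq_addr _ _).
        by apply: subset_leq_card; apply/fintype.subsetP => s.
      rewrite natrD mulrDl; apply: lerD.
        by apply: le_trans l1 _; rewrite ler_wpM2r // ler_expR lerN2.
      by apply: le_trans l2 _; rewrite ler_wpM2r // ler_expR lerN2; case: e2.
    have xx : x ^+ 2 = expR (- (sigma / 2)) by rewrite /x -expRM_natl; congr expR; field.
    rewrite ler_wpM2r // xx; apply: (@le_trans _ _ (expR 1 * expR (- sigma))).
      by have := expR_ge1Dx (1 : R); have := expR_ge0 (- sigma); nra.
    by rewrite -expRD ler_expR; lra.
  apply: le_trans (card_many_bad x01 hbad); rewrite ler_nat.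
  apply: subset_leq_card; apply/fintype.subsetP => pi; rewrite in_cnt => /asboolP[_ _ _ _].
  rewrite unfold_in /=; apply: contraTT; rewrite -ltnNge -leqNgt => hgood.
  have gd : (d <= 2 * #|[pred l | ~~ bad (pi l)]|)%N.
    have := cardC [pred l | bad (pi l)]; rewrite card_ord.
    move: hgood; move: #|_| #|_| => p q. lia.
  apply: leq_trans (leq_mul gd (leqnn _)) _; rewrite -mulnA leq_mul2l /=.
  rewrite /overlap -sum1_card big_distrl /= big_mkcond /=; apply: leq_sum => l _.
  case: ifP => //; rewrite unfold_in /= negb_or -!leqNgt mul1n => /andP[g1 g2].
  exact: leq_mul.
apply: (@le_trans _ _ (\sum_(q : {set 'I_n} * {set 'I_n} * {set 'I_n} * {set 'I_n})
    (2 * x) ^+ d * #|{ffun 'I_d -> 'S_n}|%:R)).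
  apply: le_trans (ler_sum _ (fun q _ => fixd q)); rewrite -natr_sum ler_nat.
  apply: leq_trans (cnt_exists _); apply: cnt_le => pi [A [A' [B [B' h]]]].
  by exists (A, A', B, B').
rewrite sumr_const -[X in X <= _]mulr_natl mulrA ler_wpM2r //.
have cS : #|{: {set 'I_n}}| = (2 ^ n)%N.
  rewrite -[in RHS](card_ord n) -(finset.cardsT 'I_n) -card_powerset; apply: eq_card => U.
  by rewrite powersetE finset.subsetT.
rewrite !card_prod !cS.
have -> : (2 ^ n * 2 ^ n * 2 ^ n * 2 ^ n = 2 ^ (4 * n))%N by rewrite -!expnD; congr (_ ^ _)%N; lia.
have two : 2 <= expR 1 :> R by have := expR_ge1Dx (1 : R); lra.
have h1 : (2 ^ (4 * n))%:R <= expR (4 * n%:R) :> R.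
  rewrite natrX -natrM -[(4 * n)%:R]mulr1 expRM_natl lerXn2r ?nnegrE ?expR_ge0 //.
have h2 : (2 * x) ^+ d <= expR (- (d%:R * (sigma / 8))).
  have x0 : 0 <= x by exact: expR_ge0.
  rewrite -mulrN expRM_natl lerXn2r ?nnegrE ?expR_ge0 ?mulr_ge0 //.
  apply: (@le_trans _ _ (expR 1 * x)); first by rewrite ler_wpM2r ?expR_ge0.
  by rewrite -expRD ler_expR; lra.
apply: le_trans (ler_pM _ _ h1 h2) _ => //.
  by rewrite exprn_ge0 // mulr_ge0 // expR_ge0.
by rewrite -expRD ler_expR; lra.
Qed.

End Discrepancy.

(** * Littlewood-Offord and row swaps *)

Section LittlewoodOfford.
Variable R : realType.

(** The LYM inequality, by averaging over the element [j] removed from [D]: a set [S] other than [D]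
    survives for [|D| - |S|] choices of [j], which is the ratio between the binomial coefficients of
    the two levels. *)
Lemma lym (T : finType) (D : {set T}) (F : {set {set T}}) :
  (forall S, S \in F -> S \subset D) ->
  (forall S S', S \in F -> S' \in F -> S \subset S' -> S = S') ->
  \sum_(S in F) ('C(#|D|, #|S|)%:R)^-1 <= 1 :> R.
Proof.
move: {2}#|D| (erefl #|D|) => N; elim: N D F => [|N IH] D F DN FD anti.
  have FE S : S \in F -> S = finset.set0.
    by move/FD; rewrite (cards0_eq DN) finset.subset0 => /eqP.
  case: (boolP (finset.set0 \in F)) => h0.
    rewrite (bigD1 finset.set0) //= big1 ?addr0 => [|S /andP[/FE -> ]]; last by rewrite eqxx.
    by rewrite DN cards0 bin0 invr1.
  by rewrite big1 // => S SF; move: h0; rewrite -(FE _ SF) SF.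
case: (boolP (D \in F)) => DF.
  rewrite (bigD1 D) //= big1 ?addr0 => [|S /andP[SF /negP[]]]; first by rewrite binn invr1.
  by apply/eqP; apply: anti => //; exact: FD.
have N0 : 0 < N.+1%:R :> R by [].
rewrite -(ler_pM2l N0) mulr1 mulr_sumr.
rewrite (eq_bigr (fun S : {set T} => \sum_(j in D | j \notin S) ('C(N, #|S|)%:R)^-1)); last first.
  move=> S SF; have SD := FD _ SF.
  have ltS : (#|S| < N.+1)%N.
    rewrite -DN proper_card // finset.properEneq SD andbT.
    by apply: contraNneq DF => <-.
  rewrite sumr_const [X in _ = _ *+ X](_ : _ = N.+1 - #|S|)%N; last first.
    rewrite -DN -[in RHS](finset.setIidPr SD) -cardsD; apply: eq_card => j.
    by rewrite finset.in_setD andbC.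
  rewrite DN -[RHS]mulr_natl.
  have b1 : ('C(N, #|S|)%:R : R) != 0 by rewrite pnatr_eq0 -lt0n bin_gt0 -ltnS.
  have b2 : ('C(N.+1, #|S|)%:R : R) != 0 by rewrite pnatr_eq0 -lt0n bin_gt0 ltnW.
  apply/eqP; rewrite eqr_div // -!natrM eqr_nat.
  by have /= -> := mul_bin_down N.+1 #|S|.
rewrite (exchange_big_dep (mem D)) /=; last by move=> S j _ /andP[].
apply: (@le_trans _ _ (\sum_(j in D) 1)); last by rewrite sumr_const DN.
apply: ler_sum => j jD.
have cj : #|D :\ j| = N by move: (cardsD1 j D); rewrite jD DN; lia.
set F' := [set S in F | j \notin S].
have h : \sum_(S in F') ('C(#|D :\ j|, #|S|)%:R)^-1 <= 1 :> R.
  apply: IH => // [S|S S'].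
    rewrite finset.in_set => /andP[SF jS]; apply/fintype.subsetP => x xS.
    rewrite finset.in_setD1 (fintype.subsetP (FD _ SF)) // andbT.
    by apply: contraNneq jS => <-.
  by rewrite !finset.in_set => /andP[SF _] /andP[S'F _]; exact: anti.
rewrite cj in h; apply: le_trans h.
rewrite le_eqVlt; apply/orP; left; apply/eqP; apply: eq_bigl => S.
by rewrite finset.in_set jD.
Qed.

Lemma bin_le_central (n k : nat) : ('C(n, k) <= 'C(n, n./2))%N.
Proof.
have up j : (2 * j < n)%N -> ('C(n, j) <= 'C(n, j.+1))%N.
  move=> hj; have := mul_bin_left n j.
  have : (j.+1 <= n - j)%N by lia.
  move: 'C(n, j) 'C(n, j.+1) (n - j)%N => x y z; nia.
have half j : (j <= n./2)%N -> ('C(n, j) <= 'C(n, n./2))%N.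
  move=> hj; rewrite -(subKn hj); elim: (n./2 - j)%N => [|i IHi]; first by rewrite subn0.
  case: (leqP n./2 i) => hi; first by move: IHi; rewrite (_ : n./2 - i.+1 = n./2 - i)%N //; lia.
  apply: leq_trans IHi; rewrite (_ : n./2 - i = (n./2 - i.+1).+1)%N; last by lia.
  by apply: up; lia.
case: (leqP k n) => [kn|nk]; last by rewrite bin_small.
case: (leqP k n./2) => hk; first exact: half.
by rewrite -bin_sub //; apply: half; lia.
Qed.

(** The factor [2 m + 1], rather than [2 m], is what the induction carries: its step reduces to
    [(2 m + 1) (2 m + 3) <= (2 m + 2) ^ 2]. *)
Lemma central_bin_even (m : nat) : ((2 * m).+1 * 'C(2 * m, m) ^ 2 <= 16 ^ m)%N.
Proof.
elim: m => [//|m IH].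
have e : (m.+1 * 'C(2 * m.+1, m.+1) = 2 * (2 * m).+1 * 'C(2 * m, m))%N.
  have e5 : 'C((2 * m).+1, m) = 'C((2 * m).+1, m.+1).
    have := bin_sub (leq_addl m.+1 m).
    by rewrite addnK (_ : m.+1 + m = (2 * m).+1)%N; [move=> -> | lia].
  rewrite (_ : 2 * m.+1 = (2 * m).+2)%N; last by lia.
  by rewrite binS e5 -mulnA (mul_bin_diag (2 * m).+1 m); lia.
have p : (0 < m.+1 ^ 2)%N by rewrite expn_gt0.
rewrite -(leq_pmul2l p) mulnCA -expnMn e (expnS 16).
apply: (@leq_trans (16 * m.+1 ^ 2 * ((2 * m).+1 * 'C(2 * m, m) ^ 2))%N); last first.
  by rewrite -mulnA mulnCA leq_mul2l leq_mul2l IH !orbT.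
rewrite !expnMn; set x := ('C(_, _) ^ 2)%N.
have : ((2 * m.+1).+1 * (2 ^ 2 * (2 * m).+1 ^ 2) <= 16 * m.+1 ^ 2 * (2 * m).+1)%N by nia.
by move=> h; have := leq_mul h (leqnn x); nia.
Qed.

Lemma central_bin (n : nat) : (n * 'C(n, n./2) ^ 2 <= 4 ^ n)%N.
Proof.
have := odd_double_half n; set m := n./2; case: (odd n) => /= <-; last first.
  rewrite add0n -mul2n; have := central_bin_even m.
  rewrite expnM (_ : 4 ^ 2 = 16)%N //; nia.
rewrite add1n -mul2n; have := central_bin_even m.+1.
have e : 'C(2 * m.+1, m.+1) = (2 * 'C((2 * m).+1, m))%N.
  rewrite (_ : 2 * m.+1 = (2 * m).+2)%N; last by lia.
  rewrite binS; have := bin_sub (leq_addl m.+1 m).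
  by rewrite addnK (_ : m.+1 + m = (2 * m).+1)%N; [move=> ->; lia|lia].
rewrite e !expnS expnM (_ : 4 ^ 2 = 16)%N //; set x := 'C(_, _); nia.
Qed.

(** Adding an element of [G] to [T] lowers the sum by at least [2 s], which the open window of
    length [2 s] forbids. So for a fixed part of [T] outside [G] the traces on [G] form an
    antichain, bounded by a central binomial coefficient. *)
Lemma littlewood_offord_pos (d : nat) (a : 'I_d -> R) (s c : R) : 0 < s ->
  (forall l, 0 <= a l) ->
  #|[set l | s <= a l]|%:R *
  #|[set T : {set 'I_d} | `|c + \sum_l (if l \in T then - a l else a l)| < s]|%:R
   <= Num.sqrt d%:R * 2 ^+ d :> R.
Proof.
move=> s0 a0; set G := [set l | _]; set Ev := [set T | _]; set N := #|G|.
have mono (T T' : {set 'I_d}) : T \in Ev -> T' \in Ev -> T \subset T' ->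
    T' :\: T \subset ~: G.
  rewrite !finset.in_set => hT hT' TT'; apply/fintype.subsetP => l.
  rewrite finset.in_setC finset.in_setD finset.in_set => /andP[lT lT'].
  apply/negP => sl.
  have : \sum_k (if k \in T' then - a k else a k) + 2 * s <=
         \sum_k (if k \in T then - a k else a k).
    rewrite (bigD1 l) //= [X in _ <= X](bigD1 l) //= lT' (negPf lT).
    have : \sum_(k < d | k != l) (if k \in T' then - a k else a k) <=
           \sum_(k < d | k != l) (if k \in T then - a k else a k).
      apply: ler_sum => k _; case: ifP => kT'; case: ifP => kT //.
        by have := a0 k; lra.
      by move: kT'; rewrite (fintype.subsetP TT').
    lra.
  move: hT hT'; rewrite !ltr_norml; lra.
have card1 (U : {set 'I_d}) : (#|[set T in Ev | T :\: G == U]| <= 'C(N, N./2))%N.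
  pose F := (fun T => T :&: G) @: [set T in Ev | T :\: G == U].
  have <- : #|F| = #|[set T in Ev | T :\: G == U]|.
    apply: card_in_imset => T T'; rewrite !finset.in_set => /andP[_ /eqP h1] /andP[_ /eqP h2] h3.
    by rewrite -(finset.setID T G) -(finset.setID T' G) h1 h2 h3.
  have : \sum_(S in F) ('C(N, #|S|)%:R)^-1 <= 1 :> R.
    apply: lym => [S|S S'] /imsetP[T]; rewrite finset.in_set => /andP[TE /eqP TU] ->.
      by rewrite finset.subsetIr.
    move=> /imsetP[T']; rewrite finset.in_set => /andP[TE' /eqP TU'] -> sub.
    have TT' : T \subset T'.
      by rewrite -(finset.setID T G) -(finset.setID T' G) TU TU' finset.setSU.
    have := mono _ _ TE TE' TT' => /fintype.subsetP h.
    apply/eqP; rewrite finset.eqEsubset sub /=; apply/fintype.subsetP => l.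
    rewrite !finset.in_setI => /andP[lT' lG]; rewrite lG andbT.
    apply/negPn/negP => lT; have := h l; rewrite finset.in_setD lT lT' finset.in_setC lG.
    by move=> /(_ isT).
  have c0 : 0 < ('C(N, N./2)%:R : R) by rewrite ltr0n bin_gt0; lia.
  move=> h; have : \sum_(S in F) ('C(N, N./2)%:R)^-1 <= 1 :> R.
    apply: le_trans h; apply: ler_sum => S /imsetP[T _ ->].
    rewrite lef_pV2 ?posrE // ?ler_nat ?bin_le_central //.
    by rewrite ltr0n bin_gt0 subset_leq_card // finset.subsetIr.
  by rewrite sumr_const -[X in X <= _]mulr_natl ler_pdivrMr // mul1r ler_nat.
have cE : (#|Ev| <= 2 ^ (d - N) * 'C(N, N./2))%N.
  rewrite -sum1_card (partition_big (fun T => T :\: G) (mem (powerset (~: G)))) /=; last first.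
    by move=> T _; rewrite powersetE finset.subsetDr.
  apply: (@leq_trans (\sum_(U in powerset (~: G)) 'C(N, N./2))%N).
    apply: leq_sum => U _; apply: leq_trans (card1 U).
    by rewrite sum1_card; apply: subset_leq_card; apply/fintype.subsetP => T; rewrite finset.in_set.
  rewrite sum_nat_const card_powerset; have := cardsC G; rewrite card_ord -/N.
  by move: #|~: G| => q h; rewrite (_ : q = d - N)%N // -h addKn.
have Nd : (N <= d)%N by rewrite -[X in (_ <= X)%N]card_ord max_card.
apply: (@le_trans _ _ (N%:R * (2 ^+ (d - N) * 'C(N, N./2)%:R))).
  by rewrite ler_wpM2l // -natrX -natrM ler_nat.
have h1 : Num.sqrt N%:R * 'C(N, N./2)%:R <= 2 ^+ N :> R.
  rewrite -[X in _ <= X]ger0_norm ?exprn_ge0 // -sqrtr_sqr.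
  rewrite -['C(_, _)%:R]ger0_norm // -sqrtr_sqr -sqrtrM // ler_wsqrtr //.
  rewrite -exprM mulnC exprM (_ : 2 ^+ 2 = 4%:R :> R); last by rewrite -natrX.
  by have := central_bin N; rewrite -(ler_nat R) natrM !natrX.
have h2 : Num.sqrt N%:R <= Num.sqrt d%:R :> R by rewrite ler_wsqrtr // ler_nat.
have -> : N%:R * (2 ^+ (d - N) * 'C(N, N./2)%:R) =
    Num.sqrt N%:R * 2 ^+ (d - N) * (Num.sqrt N%:R * 'C(N, N./2)%:R) :> R.
  rewrite -[in LHS](sqr_sqrtr (ler0n R N)) expr2.
  by move: (2 ^+ (d - N)) ('C(N, N./2)%:R) (Num.sqrt _) => x y z; ring.
apply: (@le_trans _ _ (Num.sqrt d%:R * 2 ^+ (d - N) * 2 ^+ N)); last first.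
  by rewrite -mulrA -exprD subnK.
rewrite ler_pM ?mulr_ge0 ?sqrtr_ge0 ?exprn_ge0 //.
by rewrite ler_wpM2r ?exprn_ge0.
Qed.

(** The symmetric difference of [T] with the set of negative coefficients is a bijection that
    replaces [a] by its absolute value. *)
Lemma littlewood_offord (d : nat) (a : 'I_d -> R) (s c : R) : 0 < s ->
  #|[set l | s <= `|a l|]|%:R *
  #|[set T : {set 'I_d} | `|c + \sum_l (if l \in T then - a l else a l)| < s]|%:R
   <= Num.sqrt d%:R * 2 ^+ d :> R.
Proof.
move=> s0; pose M := [set l | a l < 0].
pose f (T : {set 'I_d}) := [set l | (l \in T) (+) (l \in M)].
have fK : involutive f.
  by move=> T; apply/setP => l; rewrite !finset.in_set -addbA addbb addbF.
apply: le_trans (@littlewood_offord_pos d (fun l => `|a l|) s c s0 (fun l => normr_ge0 _)).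
rewrite ler_wpM2l // ler_nat -(card_imset _ (inv_inj fK)).
apply: subset_leq_card; apply/fintype.subsetP => _ /imsetP[T + ->].
rewrite !finset.in_set (_ : \sum_l _ = \sum_(l < d) (if l \in f T then - `|a l| else `|a l|)) //.
apply: eq_bigr => l _; rewrite !finset.in_set.
case: (ltrP (a l) 0) => al; case: (l \in T) => /=.
- by rewrite ltr0_norm.
- by rewrite ltr0_norm // opprK.
- by rewrite ger0_norm.
- by rewrite ger0_norm.
Qed.

End LittlewoodOfford.

(** * Random swaps of two rows *)

Section PairSwap.
Variables (R : realType) (n d : nat).
Local Notation C := R[i].
Local Notation nc := (@Normc.normc R).
Implicit Types (pi : {ffun 'I_d -> 'S_n}) (u v : 'I_n -> C).

Definition pinv pi : {ffun 'I_d -> 'S_n} := [ffun l => (pi l)^-1%g].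

Lemma pinvK : involutive pinv.
Proof. by move=> pi; apply/ffunP => l; rewrite !ffunE invgK. Qed.

(** The pairing is bilinear, without conjugation, so the adjoint is the transpose; transposing
    inverts the permutations. *)
Lemma happ_adjoint pi (Z : 'I_n -> 'I_n -> C) u v :
  \sum_i v i * happ pi Z u i = \sum_j happ (pinv pi) (fun j i => Z i j) v j * u j.
Proof.
have e1 : \sum_i v i * happ pi Z u i =
    \sum_l \sum_i v i * u (pi l i) + \sum_i \sum_j Z i j * v i * u j.
  rewrite exchange_big -big_split /=; apply: eq_bigr => i _.
  rewrite /happ mulrDr !mulr_sumr; congr (_ + _); apply: eq_bigr => j _; ring.
have e2 : \sum_j happ (pinv pi) (fun j i => Z i j) v j * u j =
    \sum_l \sum_j v ((pi l)^-1%g j) * u j + \sum_i \sum_j Z i j * v i * u j.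
  rewrite exchange_big [X in _ = _ + X]exchange_big -big_split /=; apply: eq_bigr => j _.
  rewrite /happ mulrDl !mulr_suml; congr (_ + _); apply: eq_bigr => l _ //.
  by rewrite ffunE.
rewrite e1 e2; congr (_ + _); apply: eq_bigr => l _.
rewrite [RHS](reindex_inj (@perm_inj _ (pi l))) /=.
by apply: eq_bigr => i _; rewrite permK.
Qed.

Variables (Z : 'I_n -> 'I_n -> C) (delta s : R).
Hypotheses (delta0 : 0 <= delta) (s0 : 0 < s).
Hypothesis small : (4 * n%:R + 4) * delta < s ^+ 2.

Section FixedPair.
Variables i1 i2 : 'I_n.
Hypothesis i12 : i1 != i2.

Definition row_swap (T : {set 'I_d}) pi : {ffun 'I_d -> 'S_n} :=
  [ffun l => if l \in T then (tperm i1 i2 * pi l)%g else pi l].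

Lemma row_swapK T : involutive (row_swap T).
Proof.
move=> pi; apply/ffunP => l; rewrite !ffunE; case: (l \in T) => //.
by rewrite mulgA tperm2 mul1g.
Qed.

Lemma row_swapE T pi l i :
  row_swap T pi l i = if l \in T then pi l (tperm i1 i2 i) else pi l i.
Proof. by rewrite ffunE; case: ifP => // _; rewrite permM. Qed.

Lemma happ_row_swap_out T pi u i : i != i1 -> i != i2 ->
  happ (row_swap T pi) Z u i = happ pi Z u i.
Proof.
move=> h1 h2; rewrite /happ; congr (_ + _); apply: eq_bigr => l _.
by rewrite row_swapE tpermD 1?eq_sym // if_same.
Qed.

Lemma happ_row_swap_add T pi u :
  happ (row_swap T pi) Z u i1 + happ (row_swap T pi) Z u i2 =
  happ pi Z u i1 + happ pi Z u i2.
Proof.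
have e rho : happ rho Z u i1 + happ rho Z u i2 =
   \sum_(l < d) (u (rho l i1) + u (rho l i2)) + \sum_j (Z i1 j * u j + Z i2 j * u j).
  by rewrite /happ !big_split /= addrACA.
rewrite !e; congr (_ + _); apply: eq_bigr => l _.
by rewrite !row_swapE tpermL tpermR; case: ifP => // _; rewrite addrC.
Qed.

Let gap u pi l := complex.Re (u (pi l i1)) - complex.Re (u (pi l i2)).
Let gaps u pi := #|[set l | s <= `|gap u pi l|]|.

(** A swap redistributes entries between the rows [i1] and [i2], which changes the two images but
    not their sum. This weakening of being near-null is therefore preserved. *)
Definition near_null_off u pi : Prop :=
  [/\ forall j, nc (u j) <= 1,
      forall i, i != i1 -> i != i2 -> nc (happ pi Z u i) <= delta &
      nc (happ pi Z u i1 + happ pi Z u i2) <= 2 * delta].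

Let near_null_off_swap T u pi : near_null_off u pi -> near_null_off u (row_swap T pi).
Proof.
case=> h1 h2 h3; split=> // [i a b|]; first by rewrite happ_row_swap_out // h2.
by rewrite happ_row_swap_add.
Qed.

Let gaps_swap T u pi : gaps u (row_swap T pi) = gaps u pi.
Proof.
apply: eq_card => l; rewrite !finset.in_set /gap !row_swapE tpermL tpermR.
by case: ifP => // _; rewrite distrC.
Qed.

(* Invariant under [row_swap], so that a maximiser can be chosen before the swaps are. *)
Definition max_gaps pi : nat :=
  (\max_(x < d.+1 | `[< exists2 u, near_null_off u pi & gaps u pi = x >]) x)%N.

Let max_gaps_swap T pi : max_gaps (row_swap T pi) = max_gaps pi.
Proof.
apply: eq_bigl => x; apply/asboolP/asboolP => -[u nu gu]; exists u.
- by rewrite -(row_swapK T pi); exact: near_null_off_swap.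
- by rewrite -gu gaps_swap.
- exact: near_null_off_swap.
- by rewrite gaps_swap.
Qed.

Lemma max_gaps_ge u pi : near_null_off u pi -> (gaps u pi <= max_gaps pi)%N.
Proof.
move=> nu; have gd : (gaps u pi < d.+1)%N.
  by rewrite ltnS -[X in (_ <= X)%N](card_ord d) max_card.
apply: (@leq_bigmax_cond _ _ (fun x : 'I_d.+1 => x : nat) (Ordinal gd)).
by apply/asboolP; exists u.
Qed.

(** Only existence matters here: unlike [u], the vector [v] may vary with the outcome of the
    swaps. *)
Definition left_witness pi : Prop :=
  exists v, [/\ forall j, nc (v j) <= 1,
    forall j, nc (happ (pinv pi) (fun j i => Z i j) v j) <= delta &
    s <= nc (v i1 - v i2)].

(** With [a], [b] the images on the two rows, [2 (v1 a + v2 b) = (v1 - v2) (a - b) + (v1 + v2) (a +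
    b)]. Everything but the term in [a - b] is small, by the pairing of [v] with the image of [u],
    and [|v1 - v2| >= s]. *)
Let left_witness_small u pi : near_null_off u pi -> left_witness pi ->
  `|complex.Re (happ pi Z u i1) - complex.Re (happ pi Z u i2)| < s.
Proof.
case=> u1 hu hs [v [v1 hv vs]].
set a := happ pi Z u i1 in hs *; set b := happ pi Z u i2 in hs *.
have e : (v i1 - v i2) * (a - b) = \sum_j happ (pinv pi) (fun j i => Z i j) v j * u j
   + \sum_j happ (pinv pi) (fun j i => Z i j) v j * u j
   - \sum_(i | (i != i1) && (i != i2)) v i * happ pi Z u i
   - \sum_(i | (i != i1) && (i != i2)) v i * happ pi Z u i
   - (v i1 + v i2) * (a + b).
  rewrite -happ_adjoint (bigD1 i1) //= (bigD1 i2) ?(eq_sym i2) //= -/a -/b.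
  by set x := \sum_(i | _) _; ring.
have le1 : nc (\sum_j happ (pinv pi) (fun j i => Z i j) v j * u j) <= n%:R * delta.
  apply: le_trans (nc_sum _ _ _) _.
  apply: (@le_trans _ _ (\sum_(j < n) delta)); last by rewrite sumr_const card_ord mulr_natl.
  apply: ler_sum => j _; rewrite Normc.normcM.
  by rewrite -[X in _ <= X]mulr1 ler_pM ?nc_ge0.
have le2 : nc (\sum_(i | (i != i1) && (i != i2)) v i * happ pi Z u i) <= n%:R * delta.
  apply: le_trans (nc_sum _ _ _) _.
  apply: (@le_trans _ _ (\sum_(j < n) delta)); last by rewrite sumr_const card_ord mulr_natl.
  rewrite big_mkcond /=; apply: ler_sum => j _.
  case: ifP => // /andP[j1 j2]; rewrite Normc.normcM -[X in _ <= X]mul1r.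
  by rewrite ler_pM ?nc_ge0 // hu.
have le3 : nc ((v i1 + v i2) * (a + b)) <= 2 * (2 * delta).
  rewrite Normc.normcM ler_pM ?nc_ge0 //.
  by have := ncD (v i1) (v i2); have := v1 i1; have := v1 i2; lra.
have h : nc ((v i1 - v i2) * (a - b)) <= (4 * n%:R + 4) * delta.
  rewrite e; set X := \sum_j _ in le1 *; set Y := \sum_(i | _) _ in le2 *.
  set W := (_ * (a + b)) in le3 *.
  have := ncB (X + X - Y - Y) W; have := ncB (X + X - Y) Y; have := ncB (X + X) Y.
  have := ncD X X; lra.
rewrite -raddfB; apply: le_lt_trans (Re_le_nc _) _.
rewrite -(ltr_pM2l s0) -expr2; apply: le_lt_trans small; apply: le_trans h.
by rewrite Normc.normcM ler_wpM2r // nc_ge0.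
Qed.

(** Averaging over [T] at fixed [pi]: the maximising [u] and its number of gaps are then fixed, and
    a left witness after the swap confines the signed sum of the gaps to a window, so
    Littlewood-Offord applies. *)
Lemma sum_max_gaps :
  \sum_pi (if `[< left_witness pi >] then max_gaps pi else 0%N)%:R
   <= Num.sqrt d%:R * #|{ffun 'I_d -> 'S_n}|%:R :> R.
Proof.
have p2 : 0 < 2 ^+ d :> R by rewrite exprn_gt0.
pose f pi := (if `[< left_witness pi >] then max_gaps pi else 0%N).
have cP : #|{: {set 'I_d}}| = (2 ^ d)%N.
  rewrite -[in RHS](card_ord d) -(finset.cardsT 'I_d) -card_powerset; apply: eq_card => U.
  by rewrite powersetE finset.subsetT.
have step pi : \sum_(T : {set 'I_d}) (f (row_swap T pi))%:R <= Num.sqrt d%:R * 2 ^+ d :> R.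
  case: (posnP (max_gaps pi)) => [m0|mpos].
    rewrite big1 ?mulr_ge0 ?sqrtr_ge0 ?exprn_ge0 // => T _.
    by rewrite /f max_gaps_swap m0 if_same.
  have [u nu gu] : exists2 u, near_null_off u pi & gaps u pi = max_gaps pi.
    (* The maximum is attained or is the default 0 of an empty range; [mpos] excludes the latter. *)
    have : max_gaps pi \in [pred m : nat | (m == 0%N) || `[< exists2 u, near_null_off u pi & gaps u pi = m >]].
      rewrite /max_gaps; elim/big_ind: _ => [//|x y hx hy|x hx].
        by rewrite /maxn; case: ifP.
      by rewrite inE hx orbT.
    rewrite unfold_in /= => /orP[/eqP h|/asboolP //].
    by rewrite h in mpos.
  pose c := complex.Re (\sum_j Z i1 j * u j) - complex.Re (\sum_j Z i2 j * u j).
  have := @littlewood_offord R d (gap u pi) s c s0; rewrite -/(gaps u pi) gu.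
  apply: le_trans.
  rewrite -sum1_card natr_sum mulr_sumr [X in _ <= X]big_mkcond /=; apply: ler_sum => T _.
  rewrite /f max_gaps_swap; case: ifP => [/asboolP lw|_]; last by case: ifP => // _; rewrite mulr1.
  rewrite ifT ?mulr1 // finset.in_set.
  have := left_witness_small (near_null_off_swap T nu) lw.
  rewrite (_ : _ - _ = c + \sum_l (if l \in T then - gap u pi l else gap u pi l)) //.
  rewrite /happ !raddfD /= !raddf_sum /= addrACA addrC; congr (_ + _).
    by rewrite /c !raddf_sum.
  rewrite -big_split /=; apply: eq_bigr => l _; rewrite !row_swapE tpermL tpermR /gap.
  by case: ifP => // _; rewrite opprB.
rewrite -(ler_pM2l p2).
have -> : 2 ^+ d * \sum_pi (f pi)%:R = \sum_pi \sum_(T : {set 'I_d}) (f (row_swap T pi))%:R :> R.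
  rewrite [RHS]exchange_big /= [RHS](eq_bigr (fun=> \sum_pi (f pi)%:R)); last first.
    by move=> T _; rewrite [RHS](reindex_inj (inv_inj (row_swapK T))).
  by rewrite sumr_const cP -[RHS]mulr_natl natrX.
apply: le_trans (ler_sum _ (fun pi _ => step pi)) _.
rewrite sumr_const -[X in X <= _]mulr_natr.
by rewrite le_eqVlt; apply/orP; left; apply/eqP; ring.
Qed.

End FixedPair.
End PairSwap.

(** * Double counting over pairs of rows *)

Section Unstructured.
Variables (R : realType) (n d : nat).
Local Notation C := R[i].
Local Notation nc := (@Normc.normc R).
Implicit Types (pi : {ffun 'I_d -> 'S_n}) (u v : 'I_n -> C).
Variables (Z : 'I_n -> 'I_n -> C) (delta s : R).

Definition spread_null a pi : Prop :=
  exists u v, [/\ forall j, nc (u j) <= 1, forall i, nc (happ pi Z u i) <= delta,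
    forall j, nc (v j) <= 1, forall j, nc (happ (pinv pi) (fun j i => Z i j) v j) <= delta &
    spread (fun j => complex.Re (u j)) s a /\ spread (fun j => complex.Re (v j)) s a].

Lemma overlap_pairs pi (A A' B B' : {set 'I_n}) :
  overlap pi A A' B B' = (\sum_(i1 in A') \sum_(i2 in B')
     #|[set l | (pi l i1 \in A) && (pi l i2 \in B)]|)%N.
Proof.
have e (U U' : {set 'I_n}) l :
    #|[set i in U' | pi l i \in U]| = (\sum_(i in U') (pi l i \in U))%N.
  rewrite -sum1_card big_mkcond [RHS]big_mkcond /=; apply: eq_bigr => i _.
  by rewrite finset.in_set; case: (i \in U'); case: (_ \in U).
rewrite /overlap (eq_bigr (fun l => \sum_(i1 in A') \sum_(i2 in B')
    ((pi l i1 \in A) && (pi l i2 \in B))%N)%N); last first.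
  move=> l _; rewrite !e big_distrl /=; apply: eq_bigr => i1 _.
  by rewrite big_distrr /=; apply: eq_bigr => i2 _; rewrite mulnb.
rewrite exchange_big /=; apply: eq_bigr => i1 _.
rewrite exchange_big /=; apply: eq_bigr => i2 _.
by rewrite -sum1_card [RHS]big_mkcond /=; apply: eq_bigr => l _; rewrite finset.in_set; case: (_ && _).
Qed.

(** Double counting of triples [(i1, i2, l)]: each [pi] of the event has at least [d t1 t2 / 2] of
    them, with [A], [B] taken from [u] and [A'], [B'] from [v], while each pair of rows yields at
    most [sqrt d] on average. *)
Lemma card_spread_null (a t1 t2 : nat) : 0 <= delta -> 0 < s ->
  (4 * n%:R + 4) * delta < s ^+ 2 ->
  (cnt (fun pi => spread_null a pi /\ ~ low_overlap a t1 t2 pi) * (d * (t1 * t2)))%:R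
   <= 2 * n%:R ^+ 2 * (Num.sqrt d%:R * #|{ffun 'I_d -> 'S_n}|%:R) :> R.
Proof.
move=> de0 s0 small.
pose g i1 i2 pi := (if `[< left_witness Z delta s i1 i2 pi >]
                    then max_gaps Z delta s i1 i2 pi else 0)%N.
apply: (@le_trans _ _ (2 * \sum_(i1 < n) \sum_(i2 < n | i1 != i2) \sum_pi (g i1 i2 pi)%:R));
  last first.
  set c := Num.sqrt _ * _.
  apply: (@le_trans _ _ (2 * \sum_(i1 < n) \sum_(i2 < n) c)); last first.
    rewrite !sumr_const !card_ord -mulrnA -[c *+ _]mulr_natl natrM expr2.
    by rewrite le_eqVlt; apply/orP; left; apply/eqP; ring.
  rewrite ler_wpM2l //; apply: ler_sum => i1 _.
  rewrite big_mkcond /=; apply: ler_sum => i2 _.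
  case: ifP => i12; last by rewrite mulr_ge0 ?sqrtr_ge0.
  exact: sum_max_gaps.
rewrite (_ : 2 * _ = (\sum_pi 2 * \sum_(i1 < n) \sum_(i2 < n | i1 != i2) g i1 i2 pi)%N%:R);
  last first.
  rewrite -big_distrr /= natrM; congr (_ * _).
  rewrite exchange_big /= natr_sum; apply: eq_bigr => i1 _.
  rewrite exchange_big /= natr_sum; apply: eq_bigr => i2 _.
  by rewrite natr_sum.
rewrite ler_nat /cnt -sum1_card big_distrl big_mkcond /=; apply: leq_sum => pi _.
rewrite in_cnt; case: asboolP => // -[[u [v [u1 hu v1 hv [su sv]]]] nlow].
case: su => A [B [aA nB sepu]]; case: sv => A' [B' [aA' nB' sepv]].
rewrite mul1n; apply: (@leq_trans (2 * overlap pi A A' B B')).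
  rewrite leqNgt; apply/negP => h; apply: nlow; exists A, A', B, B'; split=> //.
rewrite leq_mul2l /= overlap_pairs big_mkcond /=; apply: leq_sum => i1 _.
case: ifP => // i1A; rewrite big_mkcond [X in (_ <= X)%N]big_mkcond /=.
apply: leq_sum => i2 _; case: ifP => // i2B.
have sep := sepv _ _ i1A i2B.
have i12 : i1 != i2.
  by apply: contraTneq sep => ->; rewrite subrr normr0 -ltNge.
rewrite i12 /g ifT; last first.
  apply/asboolP; exists v; split=> //; apply: le_trans sep _.
  by rewrite -raddfB; exact: Re_le_nc.
have nn : near_null_off Z delta i1 i2 u pi.
  split=> //.
  by apply: le_trans (ncD _ _) _; have := hu i1; have := hu i2; lra.
apply: leq_trans (max_gaps_ge s nn); apply: subset_leq_card.
apply/fintype.subsetP => l; rewrite !finset.in_set => /andP[lA lB].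
exact: sepu.
Qed.

End Unstructured.

(** * Combining the estimates *)

Section NearNull.
Variables (R : realType) (n d : nat).
Local Notation C := R[i].
Local Notation nc := (@Normc.normc R).
Implicit Types (pi : {ffun 'I_d -> 'S_n}) (u v : 'I_n -> C) (Z : 'I_n -> 'I_n -> C).

Lemma sup_normalize (w : 'I_n -> C) : (exists i, w i != 0) ->
  exists i0, [/\ w i0 != 0, forall i, nc (w i) <= nc (w i0) &
                 forall i, nc (w i / w i0) <= 1].
Proof.
case=> i wi; pose i0 := [arg max_(j > i) nc (w j)]%O.
have hmax j : nc (w j) <= nc (w i0) by rewrite /i0; case: arg_maxP => // k _; apply.
have wi0 : w i0 != 0.
  apply: contraNneq wi => w0; apply/eqP/Normc.eq0_normc/eqP.
  by rewrite eq_le nc_ge0 andbT (le_trans (hmax i)) // w0 nc0.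
exists i0; split=> // j; rewrite Normc.normcM Normc.normcV.
by rewrite ler_pdivrMr ?mul1r // nc_gt0.
Qed.

(** If [M] is singular, a left kernel vector serves. Otherwise let [w] be row [j0] of the inverse.
    Expanding [u j0] gives [1 <= n delta max |w|], and [w M] is a standard basis vector, so dividing
    by the largest entry leaves at most [n delta]. *)
Lemma left_near_null (M : 'M[C]_n) u (delta : R) : (exists j, nc (u j) = 1) ->
  (forall i, nc (\sum_j M i j * u j) <= delta) ->
  exists v, [/\ forall j, nc (v j) <= 1, exists j, nc (v j) = 1 &
    forall j, nc (\sum_i v i * M i j) <= n%:R * delta].
Proof.
move=> [j0 uj0] hu.
have de0 : 0 <= delta by exact: le_trans (nc_ge0 _) (hu j0).
have nde0 : 0 <= n%:R * delta by rewrite mulr_ge0.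
case: (boolP (M \in unitmx)) => Mu; last first.
  have /det0P[w w0 wM] : \det M == 0.
    by move: Mu; rewrite unitmxE unitfE negbK.
  have [k [wk _ hk]] : exists k, [/\ w 0 k != 0, forall i, nc (w 0 i) <= nc (w 0 k) &
                 forall i, nc (w 0 i / w 0 k) <= 1].
    apply: (sup_normalize (w := fun i => w 0 i)).
    apply: contrapT => h; move/eqP: w0; apply; apply/rowP => i; rewrite mxE.
    by apply/eqP/negPn/negP => wi; apply: h; exists i.
  exists (fun i => w 0 i / w 0 k); split=> //.
    by exists k; rewrite divff // Normc.normc1.
  move=> j; rewrite (eq_bigr (fun i => (w 0 k)^-1 * (w 0 i * M i j))); last first.
    by move=> i _; ring.
  have := congr1 (fun A : 'rV_n => A 0 j) wM; rewrite !mxE -mulr_sumr => ->.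
  by rewrite mulr0 nc0.
set V := invmx M; pose w i := V j0 i.
have uE : u j0 = \sum_i w i * \sum_j M i j * u j.
  have e : V *m (M *m \col_j u j) = \col_j u j by rewrite mulmxA mulVmx // mul1mx.
  have := congr1 (fun A : 'cV_n => A j0 0) e; rewrite !mxE => <-.
  apply: eq_bigr => i _; rewrite mxE; congr (_ * _); apply: eq_bigr => j _.
  by rewrite mxE.
have [k [wk kmax hk]] : exists k, [/\ w k != 0, forall i, nc (w i) <= nc (w k) &
                 forall i, nc (w i / w k) <= 1].
  apply: sup_normalize; apply: contrapT => h.
  have w0 i : w i = 0 by apply/eqP/negPn/negP => wi; apply: h; exists i.
  move: uj0; rewrite uE big1 ?nc0; last by move=> i _; rewrite w0 mul0r.
  by move/eqP; rewrite eq_sym oner_eq0.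
exists (fun i => w i / w k); split=> //.
  by exists k; rewrite divff // Normc.normc1.
have kp : 0 < nc (w k) by exact: nc_gt0.
have big : 1 <= n%:R * delta * nc (w k).
  suff : nc (u j0) <= n%:R * delta * nc (w k) by rewrite uj0.
  rewrite uE; apply: le_trans (nc_sum _ _ _) _.
  apply: (@le_trans _ _ (\sum_(i < n) nc (w k) * delta)).
    by apply: ler_sum => i _; rewrite Normc.normcM ler_pM ?nc_ge0.
  by rewrite sumr_const card_ord -[X in X <= _]mulr_natl; lra.
move=> j; rewrite (eq_bigr (fun i => (w k)^-1 * (V j0 i * M i j))); last first.
  by move=> i _; rewrite /w; ring.
rewrite -mulr_sumr Normc.normcM Normc.normcV ler_pdivrMl // mulrC.
apply: le_trans big.
have := congr1 (fun A : 'M_n => A j0 j) (mulVmx Mu); rewrite !mxE => ->.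
by case: eqP => _; rewrite ?Normc.normc1 ?nc0.
Qed.

Definition near_null Z (delta : R) pi : Prop :=
  exists u, [/\ forall j, nc (u j) <= 1, exists j, nc (u j) = 1 &
                forall i, nc (happ pi Z u i) <= delta].

Lemma near_null_left Z delta pi : near_null Z delta pi ->
  near_null (fun j i => Z i j) (n%:R * delta) (pinv pi).
Proof.
case=> u [u1 uj hu].
pose M : 'M[C]_n := \matrix_(i, j) (\sum_(l < d) (pi l i == j)%:R + Z i j).
have ME w i : \sum_j M i j * w j = happ pi Z w i.
  rewrite /happ (eq_bigr (fun j => \sum_(l < d) (pi l i == j)%:R * w j + Z i j * w j)); last first.
    by move=> j _; rewrite mxE mulrDl mulr_suml.
  rewrite big_split /= exchange_big /=; congr (_ + _); apply: eq_bigr => l _.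
  rewrite (bigD1 (pi l i)) //= eqxx mul1r big1 ?addr0 // => j.
  by rewrite eq_sym => /negPf ->; rewrite mul0r.
have MT v j : \sum_i v i * M i j = happ (pinv pi) (fun j i => Z i j) v j.
  rewrite /happ (eq_bigr (fun i => \sum_(l < d) v i * (pi l i == j)%:R + Z i j * v i)); last first.
    by move=> i _; rewrite mxE mulrDr mulr_sumr [v i * Z i j]mulrC.
  rewrite big_split /= exchange_big /=; congr (_ + _); apply: eq_bigr => l _.
  rewrite (bigD1 (pinv pi l j)) //= ffunE permKV eqxx mulr1 big1 ?addr0 // => i.
  move=> ij; rewrite (_ : pi l i == j = false) ?mulr0 //; apply: contraNF ij => /eqP <-.
  by rewrite permK.
have [|v [v1 vj hv]] := @left_near_null M u delta uj; first by move=> i; rewrite ME.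
by exists v; split=> // j; rewrite -MT.
Qed.

Lemma happ_scale pi Z u (c : C) i : happ pi Z (fun j => c * u j) i = c * happ pi Z u i.
Proof.
rewrite /happ mulrDr !mulr_sumr; congr (_ + _); apply: eq_bigr => j _ //; ring.
Qed.

(** If only the imaginary parts are spread, multiplication by [-i] turns them into real parts, the
    only ones that the swap argument treats. *)
Lemma near_null_spread Z (delta r : R) (h a : nat) pi : (0 < n)%N -> 0 <= r ->
  (4 * a <= h)%N -> near_null Z delta pi -> ~ structured_null Z delta r h pi ->
  exists u, [/\ forall j, nc (u j) <= 1, forall i, nc (happ pi Z u i) <= delta &
                spread (fun j => complex.Re (u j)) (r / 2) a].
Proof.
move=> n0 r0 ah [u [u1 uj hu]] ns.
have mu : misses u r h by apply: contrapT => nm; apply: ns; exists u.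
case: (misses_spread n0 r0 ah mu) => [sp|[A [B [aA nB sep]]]]; first by exists u.
have ncm : nc (Complex 0 (-1)) = 1.
  by rewrite nc_def /= expr0n add0r sqrrN expr1n sqrtr1.
exists (fun j => Complex 0 (-1) * u j); split.
- by move=> j; rewrite Normc.normcM ncm mul1r.
- by move=> i; rewrite happ_scale Normc.normcM ncm mul1r.
- exists A, B; split=> // x y xA yB.
  have e z : complex.Re (Complex 0 (-1) * z) = complex.Im z :> R.
    by case: z => z1 z2 /=; ring.
  by rewrite !e; exact: sep.
Qed.

(** The tolerance is [de = n delta] because passing to the left vector loses a factor [n]. Left
    vectors obey the same estimates as right ones: [pinv] is a bijection of the sample space and the
    hypotheses on [Z] are symmetric under transposition. *)
Lemma card_near_null Z (K K0 delta sigma : R) (m q h b a t1 t2 : nat)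
    (G : finType) (pt : G -> C) :
  let r := level_radius K0 m in let de := n%:R * delta in
  (0 < n)%N -> (0 < d)%N -> (0 < q)%N -> (0 < h)%N -> (0 < b)%N -> (h <= q ^ m)%N ->
  (forall i, \sum_j Z i j = 0) -> (forall j, \sum_i Z i j = 0) ->
  (forall i j, nc (Z i j) <= K) -> d%:R + n%:R * K <= K0 -> 1 <= K0 ->
  0 <= de < r / 8 -> (4 * n%:R + 4) * de < (r / 2) ^+ 2 ->
  (forall z, nc z <= 4 -> exists a, nc (z - pt a) <= r) ->
  (n * #|G| <= 2 ^ b)%N -> (4 * b * q <= d)%N -> (256 * b * h <= n)%N ->
  (4 * a <= h)%N -> sigma = a%:R ^+ 2 / (8 * n%:R) -> 8 <= sigma ->
  40 * n%:R <= d%:R * sigma -> t1%:R <= sigma -> t2%:R <= n%:R / 32 :> R ->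
  (0 < t1)%N -> (0 < t2)%N ->
  (cnt (near_null Z delta))%:R <=
    (2 * (m%:R / 2 ^+ (2 * b)) + expR (- n%:R)
       + 2 * n%:R ^+ 2 / (Num.sqrt d%:R * (t1%:R * t2%:R)))
    * #|{ffun 'I_d -> 'S_n}|%:R :> R.
Proof.
move=> r de n0 d0 q0 h0 b0 hq Zr Zc ZK K0P K01 hde small cov nG bq bh ah sE s8 sd ht1 ht2 t10 t20.
set P := #|{ffun 'I_d -> 'S_n}|%:R.
have de0 : 0 <= delta.
  by case/andP: hde => h1 _; move: h1; rewrite /de pmulr_rge0 // ltr0n.
have dede : delta <= de by rewrite /de ler_peMl // ler1n.
have r0 : 0 < r by exact: level_radius_gt0.
pose E1 : {ffun 'I_d -> 'S_n} -> Prop := structured_null Z de r h.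
pose E2 pi := structured_null (fun j i => Z i j) de r h (pinv pi).
pose E3 := @low_overlap n d a t1 t2.
pose E4 pi := spread_null Z de (r / 2) a pi /\ ~ low_overlap a t1 t2 pi.
have sub pi : near_null Z delta pi -> (E1 pi \/ E2 pi) \/ (E3 pi \/ E4 pi).
  move=> nn.
  case: (pselect (E1 pi)) => [|nE1]; first by left; left.
  case: (pselect (E2 pi)) => [|nE2]; first by left; right.
  case: (pselect (E3 pi)) => [|nE3]; first by right; left.
  right; right; split=> //.
  have nu : near_null Z de pi.
    by case: nn => u [u1 uj hu]; exists u; split=> // i; exact: le_trans (hu i) dede.
  have [u [u1 hu su]] := near_null_spread n0 (ltW r0) ah nu nE1.
  have [v [v1 hv sv]] := near_null_spread n0 (ltW r0) ah (near_null_left nn) nE2.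
  by exists u, v.
have c12 (c : nat) : (c * 2 ^ (2 * b) <= m * #|{ffun 'I_d -> 'S_n}|)%N ->
    c%:R <= m%:R / 2 ^+ (2 * b) * P.
  rewrite -(ler_nat R) !natrM natrX => H.
  by rewrite mulrAC ler_pdivlMr // exprn_gt0.
have h1 : (cnt E1)%:R <= m%:R / 2 ^+ (2 * b) * P.
  apply: c12; exact: (card_structured_null d0 q0 h0 b0 hq Zr Zc ZK K0P K01 hde cov nG bq bh).
have h2 : (cnt E2)%:R <= m%:R / 2 ^+ (2 * b) * P.
  apply: c12; rewrite /E2 (cnt_inj (structured_null (fun j i => Z i j) de r h) (inv_inj (@pinvK n d))).
  exact: (card_structured_null d0 q0 h0 b0 hq Zc Zr (fun j i => ZK i j) K0P K01 hde cov nG bq bh).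
have hn : (h <= n)%N by rewrite (leq_trans _ bh) // leq_pmull // muln_gt0.
have an : (2 * a <= n)%N by rewrite (leq_trans _ (leq_trans ah hn)) // leq_mul2r orbT.
have h3 : (cnt E3)%:R <= expR (- n%:R) * P by exact: card_low_overlap sE s8 sd ht1 ht2.
have h4 : (cnt E4)%:R <= 2 * n%:R ^+ 2 / (Num.sqrt d%:R * (t1%:R * t2%:R)) * P.
  have r20 : 0 < r / 2 by rewrite divr_gt0.
  have de00 : 0 <= de by case/andP: hde.
  have := @card_spread_null R n d Z de (r / 2) a t1 t2 de00 r20 small.
  rewrite -/E4 -/P !natrM => H.
  have sq : 0 < Num.sqrt d%:R :> R by rewrite sqrtr_gt0 ltr0n.
  have t0 : 0 < t1%:R * t2%:R :> R by rewrite mulr_gt0 // ltr0n.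
  rewrite mulrAC ler_pdivlMr; last exact: mulr_gt0.
  rewrite -(ler_pM2l sq); move: H; rewrite -{1}(sqr_sqrtr (ler0n R d)).
  set x := Num.sqrt d%:R; set y := t1%:R * t2%:R; set z := (cnt E4)%:R => H.
  by rewrite (_ : x * (z * (x * y)) = z * (x ^+ 2 * y)); [move: H; congr (_ <= _); ring|ring].
apply: (@le_trans _ R ((cnt E1)%:R + (cnt E2)%:R + ((cnt E3)%:R + (cnt E4)%:R))).
  rewrite -!natrD ler_nat; apply: leq_trans (cnt_le sub) _.
  by apply: leq_trans (cnt_or _ _) (leq_add (cnt_or _ _) (cnt_or _ _)).
rewrite !mulrDl; clear -h1 h2 h3 h4; lra.
Qed.

End NearNull.

(** * Numerical parameters *)

Section Constants.
Variable R : realType.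
Local Notation C := R[i].
Local Notation nc := (@Normc.normc R).

Lemma truncn_half (x : R) : 2 <= x -> x / 2 <= (Num.truncn x)%:R.
Proof.
move=> x2; have /andP[_] : (Num.truncn x)%:R <= x < (Num.truncn x).+1%:R.
  by apply: truncn_itv; lra.
rewrite -natr1; lra.
Qed.

(** Squaring the bound on [a] gives [N / (2 ^ 25 B ^ 2)]. Multiplied by [2 ^ 32 B ^ 2], it leaves a
    margin of [2 ^ 7] in both remaining claims. *)
Lemma level_parameters (N B D a : R) : 1 <= B -> 2 ^+ 32 * B ^+ 2 <= N ->
  2 ^+ 32 * B ^+ 2 <= D -> N / (2 ^+ 11 * B) <= a ->
  [/\ N / (2 ^+ 25 * B ^+ 2) <= a ^+ 2 / (8 * N), 8 <= a ^+ 2 / (8 * N) &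
      40 * N <= D * (a ^+ 2 / (8 * N))].
Proof.
move=> B1 BN BD aN.
have B20 : 0 < B ^+ 2 by rewrite exprn_gt0 //; lra.
have N0 : 0 < N by lra.
have B0 : 0 < B by lra.
have B2' : 0 < 2 ^+ 25 * B ^+ 2 by lra.
have sig : N / (2 ^+ 25 * B ^+ 2) <= a ^+ 2 / (8 * N).
  rewrite ler_pdivlMr; last by lra.
  apply: (@le_trans _ _ ((N / (2 ^+ 11 * B)) ^+ 2)); last first.
    have p : 0 <= N / (2 ^+ 11 * B) by apply: divr_ge0; lra.
    by rewrite lerXn2r // nnegrE; exact: le_trans aN.
  by rewrite le_eqVlt; apply/orP; left; apply/eqP; field; lra.
split=> //.
  by apply: le_trans sig; rewrite ler_pdivlMr //; lra.
apply: (@le_trans _ _ (D * (N / (2 ^+ 25 * B ^+ 2)))); last by rewrite ler_wpM2l //; lra.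
rewrite mulrA ler_pdivlMr // mulrAC ler_pM2r //; lra.
Qed.

(** Here [t1 >= N / (2 ^ 26 B ^ 2)] and [t2 >= N / 2 ^ 6], whence the total exponent 32, and 33 with
    the factor 2. *)
Lemma overlap_parameters (N B q sigma t1 t2 : R) : 0 < N -> 1 <= B -> 0 < q ->
  N / (2 ^+ 25 * B ^+ 2) <= sigma -> sigma / 2 <= t1 -> N / 64 <= t2 ->
  2 * N ^+ 2 / (q * (t1 * t2)) <= 2 ^+ 33 * B ^+ 2 / q.
Proof.
move=> N0 B1 q0 sig t1g t2g.
have B20 : 0 < B ^+ 2 by rewrite exprn_gt0 //; lra.
have B0 : 0 < B by lra.
have B2' : 0 < 2 ^+ 25 * B ^+ 2 by lra.
have sp : 0 < N / (2 ^+ 25 * B ^+ 2) by exact: divr_gt0.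
have t10 : 0 < t1 by lra.
have t20 : 0 < t2 by lra.
have tt : N ^+ 2 / (2 ^+ 32 * B ^+ 2) <= t1 * t2.
  apply: (@le_trans _ _ ((N / (2 ^+ 25 * B ^+ 2) / 2) * (N / 64))).
    by rewrite le_eqVlt; apply/orP; left; apply/eqP; field; lra.
  by apply: ler_pM => //; lra.
have tt0 : 0 < t1 * t2 by exact: mulr_gt0.
rewrite invfM mulrA mulrAC ler_pM2r ?invr_gt0 // ler_pdivrMr //.
apply: (@le_trans _ _ (2 ^+ 33 * B ^+ 2 * (N ^+ 2 / (2 ^+ 32 * B ^+ 2)))).
  by rewrite le_eqVlt; apply/orP; left; apply/eqP; field; lra.
by rewrite ler_wpM2l //; lra.
Qed.

(* Choices: [a = n / (1024 b)], [h = 4 a], [sigma = a^2 / (8 n) >= n / (2^25 b^2)],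
   [t1 = floor sigma], [t2 = floor (n / 32)]. *)
Lemma card_near_null_bits (n d : nat) (Z : 'I_n -> 'I_n -> C) (K K0 delta : R)
    (m q b : nat) (G : finType) (pt : G -> C) :
  let r := level_radius K0 m in
  (0 < q)%N -> (0 < b)%N -> 2 ^+ 32 * b%:R ^+ 2 <= d%:R :> R ->
  2 ^+ 32 * b%:R ^+ 2 <= n%:R :> R ->
  (q ^ 2 <= d)%N -> (n <= q ^ m)%N ->
  (forall i, \sum_j Z i j = 0) -> (forall j, \sum_i Z i j = 0) ->
  (forall i j, nc (Z i j) <= K) -> d%:R + n%:R * K <= K0 -> 1 <= K0 ->
  0 <= delta -> (4 * n%:R + 4) * (n%:R * delta) < (r / 2) ^+ 2 ->
  (forall z, nc z <= 4 -> exists a, nc (z - pt a) <= r) -> (n * #|G| <= 2 ^ b)%N ->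
  (cnt (near_null (d := d) Z delta))%:R <=
    (2 * (m%:R / 2 ^+ (2 * b)) + expR (- n%:R) + 2 ^+ 33 * b%:R ^+ 2 / Num.sqrt d%:R)
    * #|{ffun 'I_d -> 'S_n}|%:R :> R.
Proof.
move=> r q0 b0 bdR bnR qd nq Zr Zc ZK K0P K01 de0 small cov nG.
have b1 : 1 <= b%:R :> R by rewrite ler1n.
have bb : b%:R <= b%:R ^+ 2 :> R by rewrite expr2 ler_peMl //; exact: le_trans b1.
have n0R : 0 < n%:R :> R by clear -b1 bb bnR; lra.
have n0 : (0 < n)%N by rewrite -(ltr0n R).
have d0 : (0 < d)%N by rewrite -(ltr0n R); clear -b1 bb bdR; lra.
pose x : R := n%:R / (2 ^+ 10 * b%:R).
have B10 : 0 < 2 ^+ 10 * b%:R :> R by clear -b1; lra.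
have x2 : 2 <= x by rewrite /x ler_pdivlMr //; clear -b1 bb bnR; lra.
pose a := Num.truncn x.
have aN : a%:R <= x by rewrite truncn_le; clear -x2; lra.
have aN' : n%:R / (2 ^+ 11 * b%:R) <= a%:R :> R.
  have := truncn_half x2; rewrite (_ : x / 2 = n%:R / (2 ^+ 11 * b%:R)) //.
  by rewrite /x; field; clear -b1; lra.
have a0 : (0 < a)%N by rewrite -(ltr0n R); clear -x2; have := truncn_half x2; rewrite -/a; lra.
have ab : (2 ^ 10 * b * a <= n)%N.
  rewrite -(ler_nat R) 2!natrM natrX; move: aN; rewrite /x ler_pdivlMr //.
  by rewrite mulrC.
pose sigma : R := a%:R ^+ 2 / (8 * n%:R).
have [sig s8 sd] := level_parameters b1 bnR bdR aN'.
rewrite -/sigma in sig s8 sd.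
pose t1 := Num.truncn sigma; pose t2 := Num.truncn (n%:R / 32 : R).
have ht1 : t1%:R <= sigma by rewrite truncn_le; clear -s8; lra.
have n64 : 64 <= n%:R :> R by clear -b1 bb bnR; lra.
have ht2 : t2%:R <= n%:R / 32 :> R by rewrite truncn_le; clear -n64; lra.
have t1g : sigma / 2 <= t1%:R by apply: truncn_half; clear -s8; lra.
have t2g : n%:R / 64 <= t2%:R :> R.
  by have := @truncn_half (n%:R / 32); rewrite -/t2; clear -n64; lra.
have t10 : (0 < t1)%N by rewrite -(ltr0n R); clear -t1g s8; lra.
have t20 : (0 < t2)%N by rewrite -(ltr0n R); clear -t2g n64; lra.
have r0 : 0 < r by exact: level_radius_gt0.
have r1 : r <= 1 / 4.
  by have := level_radius_le K01 (leq0n m); rewrite [in X in _ <= X]/level_radius expr0 invr1 mulr1.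
have hde : 0 <= n%:R * delta < r / 8.
  have y0 : 0 <= n%:R * delta by rewrite mulr_ge0.
  rewrite y0 /=; move: small; set y := n%:R * delta in y0 *; move=> sm.
  have : 4 * y <= (4 * n%:R + 4) * y by rewrite ler_wpM2r //; clear -n64; lra.
  have : (r / 2) ^+ 2 <= r / 16 by clear -r0 r1; nra.
  by clear -sm r0; lra.
(* Compared after squaring: [q ^ 2 <= d] and [16 b ^ 2 <= d]. *)
have qd4 : (4 * b * q <= d)%N.
  rewrite -(@leq_exp2r _ _ 2) //.
  have e : ((4 * b * q) ^ 2 <= (16 * b ^ 2) * d)%N.
    by rewrite !expnMn leq_mul2l qd orbT.
  apply: leq_trans e _; rewrite [X in (_ <= X)%N]expnS expn1 leq_mul2r; apply/orP; right.
  by rewrite -(ler_nat R) natrM natrX; clear -b1 bb bdR; lra.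
have hq : (4 * a <= q ^ m)%N.
  apply: leq_trans nq; apply: leq_trans ab; rewrite leq_mul2r; apply/orP; right.
  by rewrite (leq_trans _ (leq_pmulr _ b0)).
have := @card_near_null R n d Z K K0 delta sigma m q (4 * a) b a t1 t2 G pt
  n0 d0 q0 _ b0 hq Zr Zc ZK K0P K01 hde small cov nG qd4 _ (leqnn _) erefl s8 sd ht1 ht2 t10 t20.
rewrite muln_gt0 a0 => /(_ isT).
have e1 : (256 * b * (4 * a) <= n)%N.
  by apply: leq_trans ab; rewrite mulnA (mulnAC 256) (_ : 256 * 4 = 2 ^ 10)%N.
move=> /(_ e1) H; apply: le_trans H _; rewrite ler_wpM2r // lerD2l.
have sq : 0 < Num.sqrt d%:R :> R by rewrite sqrtr_gt0 ltr0n.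
exact: overlap_parameters sig t1g t2g.
Qed.

End Constants.

(** * Choice of the parameters as functions of [n] and [d] *)

Section Asymptotics.
Variable R : realType.
Local Notation C := R[i].
Local Notation nc := (@Normc.normc R).

Lemma ln2_ge : 1 / 2 <= ln 2 :> R.
Proof.
have := @le_ln1Dx R (- (1 / 2)); rewrite (_ : 1 - 1 / 2 = 2^-1 :> R); last by field.
rewrite lnV ?posrE //; lra.
Qed.

Lemma nat_powR (n : nat) (x : R) : (0 < n)%N -> n%:R `^ x = expR (x * ln n%:R).
Proof. by move=> n0; rewrite /powR pnatr_eq0 (gtn_eqF n0). Qed.

Lemma natrX_expR (n k : nat) : (0 < n)%N -> n%:R ^+ k = expR (k%:R * ln n%:R) :> R.
Proof. by move=> n0; rewrite expRM_natl lnK // posrE ltr0n. Qed.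

(* With [q] the integer part of [sqrt D], [q ^ m >= n] needs [m] of order [log_D n] only. *)
Lemma level_count (n D : nat) : (16 <= D)%N -> (D <= n)%N ->
  exists q m : nat, [/\ (0 < q)%N, (q ^ 2 <= D)%N, (n <= q ^ m)%N, (0 < m)%N &
    m%:R <= 5 * (ln n%:R / ln D%:R) :> R].
Proof.
move=> D16 Dn; pose s : R := Num.sqrt D%:R.
have D0 : 0 < D%:R :> R by rewrite ltr0n; lia.
have n0 : 0 < n%:R :> R by rewrite ltr0n; lia.
have s2 : s ^+ 2 = D%:R by rewrite sqr_sqrtr // ltW.
have s4 : 4 <= s.
  rewrite -(@ler_pXn2r _ 2) ?nnegrE ?sqrtr_ge0 // s2 -natrX ler_nat //.
pose q := Num.truncn s.
have qs : q%:R <= s by rewrite truncn_le; lra.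
have qs2 : s / 2 <= q%:R by apply: truncn_half; lra.
have q0 : 0 < q%:R :> R by lra.
have lnD : 4 * ln 2 <= ln D%:R :> R.
  rewrite -[4]/(4%:R) mulr_natl -lnXn // ler_ln ?posrE ?exprn_gt0 // -natrX ler_nat //.
have lnn : ln D%:R <= ln n%:R :> R by rewrite ler_ln ?posrE // ler_nat.
have lns : ln D%:R = 2 * ln s by rewrite -s2 lnXn ?mulr_natl //; lra.
have lnq : ln D%:R / 4 <= ln q%:R :> R.
  have : ln (s / 2) <= ln q%:R by rewrite ler_ln ?posrE //; lra.
  have sp : 0 < s by lra.
  by rewrite ln_div ?posrE //; lra.
have ln2 := ln2_ge.
have lnq0 : 0 < ln q%:R :> R by lra.
pose z : R := ln n%:R / ln q%:R; pose m := (Num.truncn z).+1.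
have /andP[m1 m2] : (Num.truncn z)%:R <= z < m%:R.
  by apply: truncn_itv; apply: divr_ge0; lra.
exists q, m; split=> //.
- by rewrite -(ltr0n R).
- by rewrite -(ler_nat R) natrX -s2 lerXn2r ?nnegrE ?sqrtr_ge0 // ltW.
- rewrite -(ler_nat R) natrX -ler_ln ?posrE ?exprn_gt0 // lnXn // -[X in _ <= X]mulr_natl.
  by rewrite -ler_pdivrMr // ltW.
rewrite /m -natr1.
have l1 : 1 <= ln n%:R / ln D%:R :> R by rewrite ler_pdivlMr; lra.
have l4 : z <= 4 * (ln n%:R / ln D%:R) :> R.
  rewrite /z mulrA ler_pdivlMr; last by lra.
  rewrite mulrAC ler_pdivrMr // -subr_ge0.
  rewrite (_ : _ - _ = ln n%:R * (4 * ln q%:R - ln D%:R)); last by ring.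
  by apply: mulr_ge0; lra.
lra.
Qed.

(* The scale [r] is polynomially small with exponent [8 gamma m], which fixes both the
   number [b] of bits of a net point and the admissible [delta]. *)
Lemma level_scale (n m : nat) (gamma L : R) : (2 <= n)%N -> 1 <= gamma -> (0 < m)%N ->
  L = ln n%:R ->
  expR (- (8 * (gamma * m%:R * L))) <= level_radius (expR ((gamma + 2) * L)) m :> R.
Proof.
move=> n2 g1 m0 LE; have n0 : (0 < n)%N by lia.
have L0 : 0 < L by rewrite LE ln_gt0 // ltr1n.
have m1 : 1 <= m%:R :> R by rewrite ler1n.
have gm : 1 <= gamma * m%:R by rewrite mulr_ege1.
have n8 : 8 <= expR (3 * L).
  have := natrX_expR 3 n0; rewrite -LE => <-.
  by rewrite -natrX ler_nat; apply: (@leq_trans (2 ^ 3)%N); rewrite ?leq_exp2r.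
have n4 : 4 <= expR (2 * L).
  have := natrX_expR 2 n0; rewrite -LE => <-.
  by rewrite -natrX ler_nat; apply: (@leq_trans (2 ^ 2)%N); rewrite ?leq_exp2r.
have k0 := expR_gt0 ((gamma + 2) * L).
have h1 : (8 * expR ((gamma + 2) * L)) ^+ m <= expR (6 * (gamma * m%:R * L)).
  rewrite (_ : 6 * (gamma * m%:R * L) = m%:R * (6 * (gamma * L))); last by ring.
  rewrite expRM_natl lerXn2r ?nnegrE ?expR_ge0 //; first by rewrite mulr_ge0 // ltW.
  apply: (@le_trans _ _ (expR (3 * L) * expR ((gamma + 2) * L))).
    by rewrite ler_wpM2r // ltW.
  rewrite -expRD ler_expR.
  have : 0 <= (gamma - 1) * L by rewrite mulr_ge0 //; lra.
  lra.
rewrite /level_radius ler_pdivlMr ?exprn_gt0 ?mulr_gt0 //.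
apply: (@le_trans _ _ (expR (- (8 * (gamma * m%:R * L))) * expR (6 * (gamma * m%:R * L)))).
  by rewrite ler_wpM2l // expR_ge0.
rewrite -expRD; apply: (@le_trans _ _ (expR (- (2 * L)))).
  rewrite ler_expR; have : 0 <= (gamma * m%:R - 1) * L by rewrite mulr_ge0 //; lra.
  lra.
by rewrite expRN mul1r lef_pV2 // posrE ?expR_gt0.
Qed.

(** All exponents are multiples of [y = gamma m L]. From [r >= exp (- 8 y)] the grid has at most
    [exp (13 y)] points per axis, and [n] times its square is at most [exp (27 y)]. As
    [m <= 5 L / ln D], the bound on [delta] gives [exp (- 24 y)], well below
    [r ^ 2 >= exp (- 16 y)]. In [C1], the 3 pays for the structured vectors and the low overlaps. *)
Lemma card_near_null_large_degree (n d : nat) (Z : 'I_n -> 'I_n -> C) (delta gamma : R) :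
  let L := ln n%:R in let D := minn d n in
  let w := 275 * gamma in let C1 := 2 ^+ 33 * w ^+ 2 + 3 in
  (2 <= n)%N -> (0 < d)%N -> 1 <= gamma -> d%:R <= expR (gamma * L) ->
  (forall i j, nc (Z i j) <= expR (gamma * L)) ->
  (forall i, \sum_j Z i j = 0) -> (forall j, \sum_i Z i j = 0) ->
  0 <= delta <= expR (- (120 * (gamma * (L / ln D%:R) * L))) ->
  C1 * L ^+ 4 < Num.sqrt D%:R ->
  (cnt (near_null (d := d) Z delta))%:R <=
     C1 * L ^+ 4 / Num.sqrt D%:R * #|{ffun 'I_d -> 'S_n}|%:R :> R.
Proof.
move=> L D w C1 n2 d0 g1 dg ZK Zr Zc /andP[de0 de1] big.
have n0 : (0 < n)%N by exact: leq_trans n2.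
have n2R : 2 <= n%:R :> R by rewrite ler_nat.
have nL : n%:R = expR L by rewrite lnK // posrE ltr0n.
have Dd : (D <= d)%N by exact: geq_minl.
have Dn : (D <= n)%N by exact: geq_minr.
have Lhalf : 1 / 2 <= L.
  by apply: le_trans ln2_ge _; rewrite ler_ln ?posrE // ltr0n.
have w1 : 275 <= w by rewrite /w; clear -g1; lra.
have w2 : 275 * w <= w ^+ 2 by rewrite expr2 ler_pM2r //; clear -w1; lra.
pose s : R := Num.sqrt D%:R.
have s2 : s ^+ 2 = D%:R by rewrite sqr_sqrtr.
have L4 : 1 / 16 <= L ^+ 4.
  have -> : 1 / 16 = (1 / 2) ^+ 4 :> R by field.
  by rewrite lerXn2r ?nnegrE //; clear -Lhalf; lra.
have s4 : 4 <= s.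
  apply: le_trans (ltW big); apply: (@le_trans _ _ (C1 * (1 / 16))).
    by rewrite /C1; clear -w1 w2; lra.
  by rewrite ler_wpM2l // /C1; clear -w1 w2; lra.
have D16 : (16 <= D)%N.
  by rewrite -(ler_nat R) -s2 (_ : 16 = 4 ^+ 2 :> R) ?lerXn2r ?nnegrE //; [exact: le_trans s4 | ring].
have D0 : (0 < D)%N by exact: leq_trans D16.
have [q [m [q0 qD nq m0 mL]]] := level_count D16 Dn.
have lnD2 : 2 <= ln D%:R :> R.
  apply: (@le_trans _ _ (ln (2 ^+ 4))).
    by rewrite lnXn // -[X in _ <= X]mulr_natl; have := ln2_ge; clear; lra.
  by rewrite ler_ln ?posrE ?exprn_gt0 ?ltr0n // -natrX ler_nat.
have LD : ln D%:R <= L by rewrite ler_ln ?posrE ?ltr0n ?ler_nat.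
have L2 : 2 <= L by exact: le_trans lnD2 LD.
set lam := L / ln D%:R in de1 mL.
have lam1 : 1 <= lam by rewrite ler_pdivlMr ?mul1r //; clear -lnD2; lra.
have lamL : lam <= L by rewrite ler_pdivrMr ?ler_peMr //; clear -lnD2 L2; lra.
have m1 : 1 <= m%:R :> R by rewrite ler1n.
pose y := gamma * m%:R * L.
have gm1 : 1 <= gamma * m%:R by rewrite mulr_ege1.
have yL : L <= y by rewrite ler_peMl //; clear -L2; lra.
pose K0 := expR ((gamma + 2) * L).
have K01 : 1 <= K0.
  by rewrite -expR0 ler_expR mulr_ge0 //; clear -g1 L2; lra.
have K0P : d%:R + n%:R * expR (gamma * L) <= K0.
  rewrite /K0 mulrDl expRD expRM_natl -nL.
  apply: (@le_trans _ _ (expR (gamma * L) * (1 + n%:R))).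
    by rewrite mulrDr mulr1 [n%:R * _]mulrC lerD2r.
  by rewrite ler_wpM2l ?expR_ge0 //; clear -n2R; nra.
pose r := level_radius K0 m.
have rl : expR (- (8 * y)) <= r by exact: (level_scale n2 g1 m0 erefl).
have r0 : 0 < r by exact: lt_le_trans (expR_gt0 _) rl.
have r1 : r <= 1 / 4.
  by have := level_radius_le K01 (leq0n m); rewrite [in X in _ <= X]/level_radius expr0 invr1 mulr1.
have [g [pt [gr cov]]] := complex_grid r0.
have n5 : 32 <= expR (5 * L).
  rewrite expRM_natl -nL (_ : 32 = 2 ^+ 5 :> R); last by ring.
  by rewrite lerXn2r ?nnegrE.
have gy : g%:R <= expR (13 * y).
  apply: le_trans gr _; apply: (@le_trans _ _ (32 * r^-1)).
    have : 1 <= r^-1 by rewrite invf_ge1 //; clear -r1; lra.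
    by clear; lra.
  apply: (@le_trans _ _ (expR (5 * L) * expR (8 * y))).
    rewrite ler_pM // ?invr_ge0 ?(ltW r0) //.
    by rewrite -[8 * y]opprK expRN lef_pV2 ?posrE ?expR_gt0.
  by rewrite -expRD ler_expR; clear -yL; lra.
(* The exponent 27 is doubled because [2 ^ b] is compared with [exp (b / 2)], by [ln 2 >= 1 / 2].
   Then [b <= 55 y] and [m <= 5 L] give 275. *)
pose b := (Num.truncn (54 * y)).+1.
have /andP[b1 b2] : (Num.truncn (54 * y))%:R <= 54 * y < b%:R.
  by apply: truncn_itv; clear -yL L2; lra.
have bw : b%:R <= w * L ^+ 2.
  apply: (@le_trans _ _ (55 * y)); first by rewrite /b -natr1; clear -b1 yL L2; lra.
  have : m%:R <= 5 * L by clear -mL lamL; lra.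
  move=> mL'; rewrite /y /w.
  have : gamma * L * m%:R <= gamma * L * (5 * L).
    by rewrite ler_wpM2l // mulr_ge0 //; clear -g1 L2; lra.
  by clear; lra.
have two b' : expR (b'%:R / 2) <= 2 ^+ b' :> R.
  rewrite expRM_natl lerXn2r ?nnegrE ?expR_ge0 //.
  rewrite -[X in _ <= X]lnK ?posrE // ler_expR; have := ln2_ge; clear; lra.
have pb : expR (27 * y) <= 2 ^+ b :> R.
  by apply: le_trans (two b); rewrite ler_expR; clear -b2; lra.
have nG : (n * #|{: 'I_g * 'I_g}| <= 2 ^ b)%N.
  rewrite card_prod !card_ord -(ler_nat R) !natrM natrX; apply: le_trans pb.
  apply: (@le_trans _ _ (expR L * (expR (13 * y) * expR (13 * y)))).
    by rewrite nL ler_wpM2l ?expR_ge0 // ler_pM.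
  by rewrite -!expRD ler_expR; clear -yL; lra.
have bD : 2 ^+ 32 * b%:R ^+ 2 <= D%:R :> R.
  rewrite -s2 (_ : 2 ^+ 32 = (2 ^+ 16) ^+ 2 :> R); last by rewrite -exprM.
  rewrite -exprMn lerXn2r ?nnegrE ?sqrtr_ge0 //; first by rewrite mulr_ge0 // exprn_ge0.
  apply: le_trans (ltW big); apply: (@le_trans _ _ (2 ^+ 16 * (w * L ^+ 2))).
    by rewrite ler_wpM2l // exprn_ge0.
  rewrite mulrA; apply: ler_pM.
  - by rewrite mulr_ge0 ?exprn_ge0 //; clear -w1; lra.
  - by rewrite exprn_ge0 //; clear -L2; lra.
  - by rewrite /C1; clear -w1 w2; lra.
  - by apply: ler_weXn2l => //; clear -L2; lra.
have small : (4 * n%:R + 4) * (n%:R * delta) < (r / 2) ^+ 2.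
  have e1 : delta <= expR (- (24 * y)).
    apply: le_trans de1 _; rewrite ler_expR lerN2 /y.
    have : gamma * L * m%:R <= gamma * L * (5 * lam).
      by rewrite ler_wpM2l // mulr_ge0 //; clear -g1 L2; lra.
    by clear; lra.
  have e2 : expR (- (8 * y)) ^+ 2 <= r ^+ 2.
    by rewrite lerXn2r ?nnegrE ?expR_ge0 // ltW.
  have e3 : 4 * ((4 * n%:R + 4) * n%:R) <= expR (7 * L).
    apply: (@le_trans _ _ (expR (5 * L) * expR (2 * L))); last by rewrite -expRD ler_expR; clear; lra.
    apply: (@le_trans _ _ (32 * n%:R ^+ 2)); first by clear -n2R; nra.
    by rewrite [expR (2 * L)]expRM_natl -nL ler_wpM2r // exprn_ge0.
  rewrite -expRM_natl in e2.
  have e4 : expR (7 * L) * expR (- (24 * y)) < expR (2 * - (8 * y)).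
    by rewrite -expRD ltr_expR; clear -yL L2; lra.
  have e5 : 4 * ((4 * n%:R + 4) * n%:R) * delta <= expR (7 * L) * expR (- (24 * y)).
    apply: ler_pM => //; rewrite !mulr_ge0 // addr_ge0 // mulr_ge0 //.
  by rewrite expr_div_n; move: (r ^+ 2) e2 => r2 e2; clear -e2 e4 e5; lra.
have b0 : (0 < b)%N by [].
have Dd' : D%:R <= d%:R :> R by rewrite ler_nat.
have Dn' : D%:R <= n%:R :> R by rewrite ler_nat.
have H := card_near_null_bits q0 b0 (le_trans bD Dd') (le_trans bD Dn')
  (leq_trans qD Dd) nq Zr Zc ZK K0P K01 de0 small cov nG.
apply: le_trans H _; rewrite ler_wpM2r //.
have sd : s <= Num.sqrt d%:R by rewrite ler_wsqrtr.
have s0 : 0 < s by clear -s4; lra.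
have L41 : 1 <= L ^+ 4 by rewrite exprn_ege1 //; clear -L2; lra.
have sn : s <= n%:R.
  by apply: le_trans Dn'; rewrite -s2 expr2 ler_peMl //; clear -s4; lra.
(* One factor [2 ^ b] absorbs the number of levels, the other supplies [sqrt D]. *)
have t1 : m%:R / 2 ^+ (2 * b) <= s^-1.
  have mb : m%:R <= 2 ^+ b :> R.
    apply: le_trans pb; apply: (@le_trans _ _ (27 * y)); last by have := expR_ge1Dx (27 * y); clear; lra.
    have : m%:R <= y.
      by rewrite /y mulrAC ler_peMl // mulr_ege1 //; clear -L2; lra.
    by clear -yL L2; lra.
  have sb : s <= 2 ^+ b.
    by apply: le_trans sn _; apply: le_trans pb; rewrite nL ler_expR; clear -yL L2; lra.
  have p0 : 0 < 2 ^+ b :> R by rewrite exprn_gt0.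
  rewrite mul2n -addnn exprD ler_pdivrMr ?mulr_gt0 //.
  rewrite mulrA; apply: le_trans mb _; rewrite ler_peMl ?(ltW p0) //.
  by rewrite mulrC ler_pdivlMr // mul1r.
have t2 : expR (- n%:R) <= s^-1 :> R.
  rewrite expRN lef_pV2 ?posrE ?expR_gt0 //; apply: le_trans sn _.
  by have := expR_ge1Dx (n%:R : R); clear; lra.
have t3 : 2 ^+ 33 * b%:R ^+ 2 / Num.sqrt d%:R <= 2 ^+ 33 * w ^+ 2 * L ^+ 4 * s^-1.
  apply: ler_pM.
  - by rewrite mulr_ge0 // exprn_ge0.
  - by rewrite invr_ge0 sqrtr_ge0.
  - rewrite -mulrA ler_wpM2l ?exprn_ge0 // (_ : w ^+ 2 * L ^+ 4 = (w * L ^+ 2) ^+ 2); last by ring.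
    by rewrite lerXn2r ?nnegrE //; exact: le_trans bw.
  - by rewrite lef_pV2 ?posrE //; exact: lt_le_trans sd.
rewrite -/s /C1 (_ : (2 ^+ 33 * w ^+ 2 + 3) * L ^+ 4 / s =
   2 * (L ^+ 4 * s^-1) + L ^+ 4 * s^-1 + 2 ^+ 33 * w ^+ 2 * L ^+ 4 * s^-1); last by ring.
have t4 : s^-1 <= L ^+ 4 * s^-1 by rewrite ler_peMl // invr_ge0 ltW.
apply: lerD t3; apply: lerD; last exact: le_trans t4.
by rewrite ler_wpM2l //; exact: le_trans t4.
Qed.

End Asymptotics.

(** * From the smallest singular value to near-null vectors *)

Section Reduction.
Variable R : realType.
Local Notation C := R[i].
Local Notation nc := (@Normc.normc R).

Lemma vnorm_sqr (n : nat) (u : 'cV[C]_n) : vnorm u ^+ 2 = \sum_i nc (u i 0) ^+ 2.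
Proof. by rewrite sqr_sqrtr // sumr_ge0 // => i _; rewrite sqr_ge0. Qed.

Lemma vnorm_ge0 (n : nat) (u : 'cV[C]_n) : 0 <= vnorm u.
Proof. exact: sqrtr_ge0. Qed.

Lemma nc_le_vnorm (n : nat) (u : 'cV[C]_n) i : nc (u i 0) <= vnorm u.
Proof.
rewrite -(@ler_pXn2r _ 2) ?nnegrE ?nc_ge0 ?vnorm_ge0 // vnorm_sqr (bigD1 i) //=.
by rewrite lerDl sumr_ge0 // => j _; rewrite sqr_ge0.
Qed.

Lemma vnorm_le_sum (n : nat) (u : 'cV[C]_n) : vnorm u <= \sum_i nc (u i 0).
Proof.
have s0 : 0 <= \sum_i nc (u i 0) by apply: sumr_ge0 => i _; exact: nc_ge0.
rewrite -(@ler_pXn2r _ 2) ?nnegrE ?vnorm_ge0 // vnorm_sqr [X in _ <= X]expr2 mulr_suml.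
apply: ler_sum => i _; rewrite expr2 ler_wpM2l ?nc_ge0 // (bigD1 i) //= lerDl.
by apply: sumr_ge0 => j _; exact: nc_ge0.
Qed.

Lemma vnormZ (n : nat) (c : C) (u : 'cV[C]_n) : vnorm (c *: u) = nc c * vnorm u.
Proof.
apply/eqP; rewrite -(@eqrXn2 _ 2) ?vnorm_ge0 ?mulr_ge0 ?nc_ge0 ?vnorm_ge0 //.
rewrite exprMn !vnorm_sqr mulr_sumr; apply/eqP; apply: eq_bigr => i _.
by rewrite mxE Normc.normcM exprMn.
Qed.

(** Pythagoras for the splitting into a constant vector and a vector of sum zero. *)
Lemma sum_nc_sqr_shift (n : nat) (a : C) (x : 'I_n -> C) : \sum_i x i = 0 ->
  \sum_i nc (a + x i) ^+ 2 = n%:R * nc a ^+ 2 + \sum_i nc (x i) ^+ 2.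
Proof.
move=> x0.
have r0 : \sum_i complex.Re (x i) = 0 by rewrite -raddf_sum x0.
have m0 : \sum_i complex.Im (x i) = 0 by rewrite -raddf_sum x0.
rewrite (eq_bigr (fun i => nc a ^+ 2 + nc (x i) ^+ 2 +
  (2 * complex.Re a) * complex.Re (x i) + (2 * complex.Im a) * complex.Im (x i))); last first.
  by move=> i _; rewrite !nc_sqr !raddfD /=; ring.
have e1 : \sum_i (2 * complex.Re a) * complex.Re (x i) = 0 by rewrite -mulr_sumr r0 mulr0.
have e2 : \sum_i (2 * complex.Im a) * complex.Im (x i) = 0 by rewrite -mulr_sumr m0 mulr0.
by rewrite !big_split /= e1 e2 !addr0 sumr_const card_ord mulr_natl.
Qed.

Variables (n d : nat) (Z : 'M[C]_n) (zeta : C).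
Hypothesis Zrow : forall i, \sum_j Z i j = zeta.
Hypothesis Zcol : forall j, \sum_i Z i j = zeta.
Hypothesis n0 : (0 < n)%N.

Let n0C : n%:R != 0 :> C.
Proof. by rewrite pnatr_eq0 -lt0n. Qed.

Let Z' i j := Z i j - zeta / n%:R.

Lemma centered_row i : \sum_j Z' i j = 0.
Proof. by rewrite sumrB Zrow sumr_const card_ord -[X in _ - X]mulr_natr divfK ?subrr. Qed.

Lemma centered_col j : \sum_i Z' i j = 0.
Proof. by rewrite sumrB Zcol sumr_const card_ord -[X in _ - X]mulr_natr divfK ?subrr. Qed.

Lemma Ssum_mulE (pi : {ffun 'I_d -> 'S_n}) (u : 'cV[C]_n) i :
  ((Ssum R pi + Z) *m u) i 0 = happ pi Z' (fun j => u j 0) i + zeta / n%:R * \sum_j u j 0.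
Proof.
rewrite mulmxDl mxE /Ssum mulmx_suml summxE /happ -addrA; congr (_ + _).
  apply: eq_bigr => l _; rewrite mxE (bigD1 (pi l i)) //= big1 ?addr0.
    by rewrite !mxE eqxx mul1r.
  by move=> j jn; rewrite !mxE eq_sym (negPf jn) mul0r.
rewrite mxE mulr_sumr -big_split /=; apply: eq_bigr => j _; rewrite /Z'; ring.
Qed.

(** In [u = c 1 + x] both the vector and its image split orthogonally, and the constant part is
    stretched by [|d + zeta| >= mu]. So the image of [x] is shorter than [mu] times [x]. The factor
    [n] covers the change to the sup norm. *)
Lemma smin_near_null (pi : {ffun 'I_d -> 'S_n}) (mu : R) :
  smin (Ssum R pi + Z) < mu -> mu <= nc (d%:R + zeta) ->
  exists w : 'I_n -> C, [/\ forall j, nc (w j) <= 1, exists j, nc (w j) = 1,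
     \sum_j w j = 0 & forall i, nc (happ pi Z' w i) <= n%:R * mu].
Proof.
move=> hs mud.
have [_ [u u1 <-] hu] : exists2 y, [set vnorm ((Ssum R pi + Z) *m u) | u in
    [set u : 'cV[C]_n | vnorm u = 1]]%classic y & y < mu.
  apply: inf_lt hs; pose k := Ordinal n0.
  exists (vnorm ((Ssum R pi + Z) *m delta_mx k 0)); exists (delta_mx k 0) => //=.
  apply/eqP; rewrite -(@eqrXn2 _ 2) ?vnorm_ge0 // vnorm_sqr (bigD1 k) //= big1.
    by rewrite addr0 mxE !eqxx Normc.normc1.
  by move=> j jk; rewrite mxE (negPf jk) nc0 expr0n.
rewrite /= in u1; pose c := (\sum_j u j 0) / n%:R; pose x j := u j 0 - c.
have mu0 : 0 < mu by exact: le_lt_trans (vnorm_ge0 _) hu.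
have x0 : \sum_j x j = 0.
  by rewrite sumrB sumr_const card_ord -[X in _ - X]mulr_natr divfK ?subrr.
have Mu i : ((Ssum R pi + Z) *m u) i 0 = c * (d%:R + zeta) + happ pi Z' x i.
  rewrite Ssum_mulE (happ_split pi (fun j => u j 0) x c i centered_row).
  rewrite (_ : happ pi Z' (fun j => u j 0 - c - x j) i = 0).
    have -> : \sum_j u j 0 = c * n%:R by rewrite divfK.
    by rewrite addr0 /happ; field.
  rewrite /happ !big1 ?addr0 // => j _; rewrite /x subrr ?mulr0 //.
have hx0 : \sum_i happ pi Z' x i = 0.
  by rewrite (sum_happ pi x centered_col) x0 mulr0.
have e1 : vnorm ((Ssum R pi + Z) *m u) ^+ 2 =
    n%:R * nc (c * (d%:R + zeta)) ^+ 2 + \sum_i nc (happ pi Z' x i) ^+ 2.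
  by rewrite vnorm_sqr -(sum_nc_sqr_shift _ hx0); apply: eq_bigr => i _; rewrite Mu.
have e2 : 1 = n%:R * nc c ^+ 2 + \sum_i nc (x i) ^+ 2.
  rewrite -(sum_nc_sqr_shift _ x0) -[LHS](expr1n _ 2) -u1 vnorm_sqr.
  by apply: eq_bigr => i _; rewrite /x addrC subrK.
have lt : \sum_i nc (happ pi Z' x i) ^+ 2 < mu ^+ 2 * \sum_i nc (x i) ^+ 2.
  have h1 : vnorm ((Ssum R pi + Z) *m u) ^+ 2 < mu ^+ 2.
    by rewrite ltr_pXn2r ?nnegrE ?vnorm_ge0 // ltW.
  have h2 : mu ^+ 2 <= nc (d%:R + zeta) ^+ 2.
    by rewrite lerXn2r ?nnegrE ?nc_ge0 // ltW.
  have h3 : 0 <= n%:R * nc c ^+ 2 by rewrite mulr_ge0 // sqr_ge0.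
  have h4 := ler_wpM2l h3 h2.
  move: e1; rewrite Normc.normcM exprMn => e1.
  have -> : \sum_i nc (x i) ^+ 2 = 1 - n%:R * nc c ^+ 2.
    by apply/eqP; rewrite eq_sym subr_eq [X in _ == X]addrC -e2.
  rewrite mulrBr mulr1; move: h1; rewrite e1.
  move: (\sum_i _) (mu ^+ 2) (nc (d%:R + zeta) ^+ 2) h4 => S m2 z2 h4.
  lra.
have [k [xk kmax kn]] : exists k, [/\ x k != 0, forall i, nc (x i) <= nc (x k) &
     forall i, nc (x i / x k) <= 1].
  apply: sup_normalize; apply: contrapT => h.
  have xi i : x i = 0 by apply/eqP/negPn/negP => xi; apply: h; exists i.
  move: lt; rewrite [X in _ * X]big1 ?mulr0; last by move=> i _; rewrite xi nc0 expr0n.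
  by apply/negP; rewrite -leNgt sumr_ge0 // => i _; rewrite sqr_ge0.
have kp : 0 < nc (x k) by exact: nc_gt0.
exists (fun j => (x k)^-1 * x j); split.
- by move=> j; rewrite mulrC.
- by exists k; rewrite mulVf // Normc.normc1.
- by rewrite -mulr_sumr x0 mulr0.
move=> i; rewrite happ_scale Normc.normcM Normc.normcV ler_pdivrMl //.
have sx : \sum_i nc (x i) ^+ 2 <= n%:R * nc (x k) ^+ 2.
  apply: (@le_trans _ _ (\sum_(j < n) nc (x k) ^+ 2)); last first.
    by rewrite sumr_const card_ord mulr_natl.
  apply: ler_sum => j _.
  by rewrite lerXn2r ?nnegrE ?nc_ge0.
rewrite -(@ler_pXn2r _ 2) ?nnegrE ?nc_ge0 ?mulr_ge0 ?nc_ge0 ?(ltW mu0) //.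
apply: (@le_trans _ _ (\sum_i nc (happ pi Z' x i) ^+ 2)).
  by rewrite (bigD1 i) //= lerDl sumr_ge0 // => j _; rewrite sqr_ge0.
apply: le_trans (ltW lt) _; apply: le_trans (ler_wpM2l (sqr_ge0 _) sx) _.
rewrite !exprMn.
have n1 : n%:R <= n%:R ^+ 2 :> R by rewrite expr2 ler_peMl // ler1n.
have p : 0 <= nc (x k) ^+ 2 * mu ^+ 2 by rewrite mulr_ge0 // sqr_ge0.
by have := ler_wpM2r p n1; lra.
Qed.

(** As the rows of [Z] sum to [zeta], column [j] of [Z'] is the image under [Z] of the [j]-th basis
    vector minus its mean, which is orthogonal to the constants and has norm at most 2. *)
Lemma centered_entry (K : R) : (2 <= n)%N -> opnorm_perp1 Z <= K ->
  forall i j, nc (Z' i j) <= 2 * K.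
Proof.
move=> n2 ZK i j.
pose e : 'cV[C]_n := delta_mx j 0 - const_mx n%:R^-1.
have eE k : e k 0 = (k == j)%:R - n%:R^-1 by rewrite !mxE andbT.
have se : \sum_k e k 0 = 0.
  rewrite (eq_bigr _ (fun k _ => eE k)) sumrB sumr_const card_ord (bigD1 j) //= eqxx.
  rewrite big1 ?addr0; last by move=> k /negPf ->.
  by rewrite -[X in _ - X]mulr_natr mulVf // subrr.
have nV : nc n%:R^-1 = n%:R^-1 by rewrite Normc.normcV nc_nat.
have e2 : vnorm e <= 2.
  apply: le_trans (vnorm_le_sum _) _.
  apply: (@le_trans _ _ (\sum_k ((k == j)%:R + n%:R^-1))).
    apply: ler_sum => k _; rewrite eE; apply: le_trans (ncB _ _) _.
    by rewrite nV nc_nat.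
  rewrite big_split /= sumr_const card_ord (bigD1 j) //= eqxx big1 ?addr0; last first.
    by move=> k /negPf ->.
  by rewrite -[X in _ + X <= _]mulr_natr mulVf // pnatr_eq0 -lt0n.
have e0 : 0 < vnorm e.
  have [k kj] : exists k : 'I_n, k != j.
    have /card_gt1P[a [b [_ _ ab]]] : (1 < #|'I_n|)%N by rewrite card_ord.
    by case: (eqVneq a j) ab => [->|aj] ab; [exists b; rewrite eq_sym | exists a].
  apply: lt_le_trans (nc_le_vnorm e k); rewrite eE (negPf kj) sub0r ncN nV.
  by rewrite invr_gt0 ltr0n.
have Ze : (Z *m e) i 0 = Z' i j.
  rewrite mxE (eq_bigr (fun k => Z i k * (k == j)%:R - Z i k / n%:R)); last first.
    by move=> k _; rewrite eE mulrBr.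
  rewrite sumrB -mulr_suml Zrow (bigD1 j) //= eqxx mulr1 big1 ?addr0 //.
  by move=> k /negPf ->; rewrite mulr0.
pose a : C := real_complex R (vnorm e)^-1.
have na : nc a = (vnorm e)^-1.
  by rewrite nc_def /= expr0n addr0 sqrtr_sqr ger0_norm // invr_ge0 vnorm_ge0.
have bnd : vnorm (Z *m (a *: e)) <= opnorm_perp1 Z.
  apply: ub_le_sup; last first.
    exists (a *: e) => //; split; first by rewrite vnormZ na mulVf // gt_eqF.
    by rewrite (eq_bigr (fun k => a * e k 0)) -?mulr_sumr ?se ?mulr0 // => k _; rewrite mxE.
  exists (\sum_i \sum_j nc (Z i j)) => _ [u [u1 _] <-].
  apply: le_trans (vnorm_le_sum _) _; apply: ler_sum => k _.
  rewrite mxE; apply: le_trans (nc_sum _ _ _) _; apply: ler_sum => l _.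
  rewrite Normc.normcM ler_piMr ?nc_ge0 //.
  by rewrite -u1 nc_le_vnorm.
move: bnd; rewrite -scalemxAr vnormZ na ler_pdivrMl // => bnd.
have K0 : 0 <= opnorm_perp1 Z.
  rewrite -(pmulr_rge0 _ e0); exact: le_trans (vnorm_ge0 (Z *m e)) bnd.
rewrite -Ze; apply: le_trans (nc_le_vnorm _ _) _; apply: le_trans bnd _.
by apply: ler_pM => //; exact: vnorm_ge0.
Qed.

End Reduction.

Theorem theorem2p2 (R : realType) :
  exists Cbar : R, forall gamma0 : R, 1 <= gamma0 ->
  exists C : R, forall (n d : nat) (Z : 'M[R[i]]_n) (zeta : R[i]),
    (0 < n)%N -> (0 < d)%N ->
    (d%:R <= (n%:R : R) `^ gamma0) ->
    opnorm_perp1 Z <= (n%:R : R) `^ gamma0 ->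
    Z *m ones R n = zeta *: ones R n ->
    adjmx Z *m ones R n = conjc zeta *: ones R n ->
    Pperm R (n:=n) (d:=d) (fun pi =>
      smin (Ssum R pi + Z) <
        Num.min ((n%:R : R) `^ (- (Cbar * gamma0 *
                   (ln (n%:R : R) / ln ((minn d n)%:R : R)))))
                (Normc.normc (d%:R + zeta)))
    <= C * (ln (n%:R : R)) ^+ 4 / Num.sqrt ((minn d n)%:R : R).
Proof.
(* The entries of [Z'] are at most [2 n ^ g <= n ^ (2 g)], so [gamma = 2 g] and [delta] must be at
   most [n ^ (- 240 g L / ln D)]; the surplus 20 absorbs the factor [n] from the change of norm. *)
exists 260 => g g1; pose w := 275 * (2 * g).
exists (2 ^+ 33 * w ^+ 2 + 3) => n d Z zeta n0 d0 dg op Z1 Z2.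
have Zrow i : \sum_j Z i j = zeta.
  have := congr1 (fun A : 'cV_n => A i 0) Z1; rewrite !mxE mulr1 => <-.
  by apply: eq_bigr => j _; rewrite mxE mulr1.
have Zcol j : \sum_i Z i j = zeta.
  apply: (inv_inj (@conjcK R)).
  have := congr1 (fun A : 'cV_n => A j 0) Z2; rewrite !mxE mulr1 => <-.
  by rewrite rmorph_sum; apply: eq_bigr => i _; rewrite !mxE mulr1.
set E := (fun pi : {ffun 'I_d -> 'S_n} => _).
set P : R := #|{ffun 'I_d -> 'S_n}|%:R.
have P0 : 0 < P by rewrite ltr0n; apply/card_gt0P; exists [ffun=> 1%g].
have w1 : 550 <= w by rewrite /w; lra.
have w2 : 0 <= w ^+ 2 by rewrite sqr_ge0.
set C1 : R := 2 ^+ 33 * w ^+ 2 + 3.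
have C1p : 16 <= C1.
  have : 550 * 550 <= w ^+ 2 by rewrite expr2 ler_pM.
  by rewrite /C1; lra.
have EP pi : E pi -> exists v : 'I_n -> R[i],
    [/\ forall j, Normc.normc (v j) <= 1, exists j, Normc.normc (v j) = 1,
        \sum_j v j = 0 & forall i, Normc.normc (happ pi (fun i j => Z i j - zeta / n%:R) v i)
          <= n%:R * n%:R `^ (- (260 * g * (ln n%:R / ln (minn d n)%:R)))].
  rewrite /E => h; have := h; rewrite lt_min => /andP[h1 h2].
  have [|v [v1 vj v0 hv]] := smin_near_null Zrow Zcol n0 h.
    by rewrite ge_min lexx orbT.
  exists v; split=> // i; apply: le_trans (hv i) _.
  by rewrite ler_wpM2l // ge_min lexx.
(* For [n = 1] the bound is 0 since [ln 1 = 0], and the event is empty: a vector of sum zero cannot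
   have an entry of modulus 1. *)
case: (ltnP 1 n) => [n2|n1]; last first.
  have E0 : #|E| = 0%N.
    apply: eq_card0 => pi; apply/negP => /EP[v [_ [j vj] v0 _]].
    move: vj; rewrite (_ : v j = 0); first by rewrite nc0 => /eqP; rewrite eq_sym oner_eq0.
    rewrite -[RHS]v0 (bigD1 j) //= big1 ?addr0 // => k /eqP[]; apply/val_inj => /=.
    by move: (ltn_ord k) (ltn_ord j); lia.
  rewrite /Pperm E0 mul0r; apply: divr_ge0; last exact: sqrtr_ge0.
  apply: mulr_ge0; first by lra.
  by rewrite exprn_ge0 // ln_ge0 // ler1n.
set D := minn d n; set L : R := ln n%:R.
have D0 : (0 < D)%N by rewrite leq_min d0.
have s0 : 0 < Num.sqrt D%:R :> R by rewrite sqrtr_gt0 ltr0n.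
have EleP : #|E|%:R <= P by rewrite ler_nat max_card.
(* If [sqrt D] is this small, the claimed bound is at least 1. This includes [D = 1], where the
   exponent of the threshold is a division by [ln 1 = 0]. *)
case: (lerP (Num.sqrt D%:R) (C1 * L ^+ 4)) => [small|big].
  rewrite /Pperm; apply: (@le_trans _ _ 1); first by rewrite ler_pdivrMr // mul1r.
  by rewrite ler_pdivlMr // mul1r.
rewrite /Pperm ler_pdivrMr //.
have n2R : 2 <= n%:R :> R by rewrite ler_nat.
have nL : n%:R = expR L by rewrite lnK // posrE ltr0n.
have Lhalf : 1 / 2 <= L by apply: le_trans (ln2_ge R) _; rewrite ler_ln ?posrE // ltr0n.
have L4 : 1 / 16 <= L ^+ 4.
  have -> : 1 / 16 = (1 / 2) ^+ 4 :> R by field.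
  by rewrite lerXn2r ?nnegrE //; clear -Lhalf; lra.
have s1 : 1 < Num.sqrt D%:R :> R.
  apply: le_lt_trans big; apply: (@le_trans _ _ (16 * (1 / 16))); first by clear; lra.
  by apply: ler_pM => //; clear; lra.
have D1 : 1 < D%:R :> R.
  by rewrite -(sqr_sqrtr (ler0n R D)) expr_gt1 // ltW.
have lnD : 0 < ln D%:R :> R by rewrite ln_gt0.
have lam1 : 1 <= L / ln D%:R.
  by rewrite ler_pdivlMr // mul1r ler_ln ?posrE ?ltr0n // ler_nat geq_minr.
have npow x : n%:R `^ x = expR (x * L) by rewrite nat_powR.
have gL : 0 <= g * L by clear -g1 Lhalf; apply: mulr_ge0; lra.
have g2 : 1 <= 2 * g by clear -g1; lra.
have dg2 : d%:R <= expR (2 * g * L).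
  by apply: le_trans dg _; rewrite npow ler_expR; clear -gL; lra.
have ent i j : Normc.normc (Z i j - zeta / n%:R) <= expR (2 * g * L).
  apply: le_trans (centered_entry Zrow n0 n2 op i j) _.
  rewrite npow; apply: (@le_trans _ _ (expR L * expR (g * L))).
    by rewrite -nL ler_wpM2r // expR_ge0.
  rewrite -expRD ler_expR; clear -g1 Lhalf.
  have : 0 <= (g - 1) * L by apply: mulr_ge0; lra.
  by lra.
pose delta := n%:R * n%:R `^ (- (260 * g * (L / ln D%:R))).
have dl : 0 <= delta <= expR (- (120 * (2 * g * (L / ln D%:R) * L))).
  rewrite mulr_ge0 ?powR_ge0 //= /delta npow nL -expRD ler_expR.
  move: (L / ln D%:R) lam1 => z z1; clear -g1 Lhalf z1.
  have gz : 1 <= g * z by rewrite mulr_ege1.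
  have : 0 <= (g * z - 1) * L by apply: mulr_ge0; lra.
  by lra.
have H := card_near_null_large_degree n2 d0 g2 dg2 ent (centered_row Zrow n0) (centered_col Zcol n0) dl big.
apply: le_trans H; rewrite ler_nat; apply: subset_leq_card; apply/fintype.subsetP => pi hE.
rewrite in_cnt; apply/asboolP; have [v [v1 vj _ hv]] := EP pi hE.
by exists v.
Qed.
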